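(* Let $0<s<1$ be rational. Let $B\subseteq\omega^\omega$ be a basis for $\Sigma^1_1$, and let $E\subseteq2^\omega$ be a $\Sigma^1_1$ class with $\mathcal H^s(E)>0$. Then there exists $f\in B$ such that $E$ has a $\Pi^0_1(f)$ subclass $C$ with $\mathcal H^s(C)>0$. In particular (taking $B=\{x: x\le_T\mathcal O\}$), every $\Sigma^1_1$ class of non-zero $\mathcal H^s$-measure has a $\Pi^0_1(\mathcal O)$ subclass of non-zero $\mathcal H^s$-measure.
   Context: A set $B\subseteq\omega^\omega$ is a basis for $\Sigma^1_1$ if every nonempty (lightface) $\Sigma^1_1$ subset of $\omega^\omega$ has a member in $B$. $\mathcal O$ is Kleene's $\mathcal O$ (a $\Pi^1_1$-complete set). Cantor space $2^\omega$ carries the metric $d(x,y)=2^{-\min\{n:x(n)\ne y(n)\}}$ for $x\ne y$; $\mathcal H^s$ denotes $s$-dimensional Hausdorff measure with respect to this metric. *)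

(* Defs.v *)
From Stdlib Require Import Reals List Arith Cantor.
Import ListNotations.
Open Scope R_scope.

(* Computability: total functions nat -> nat recursive in an oracle f. *)
(* Unary presentation using the Cantor pairing Cantor.to_nat/of_nat:    *)
(* the least class containing zero, successor, the two projections     *)
(* and the oracle, closed under pairing, composition, primitive         *)
(* recursion and (total) minimisation.  By Kleene's normal form theorem *)
(* these are exactly the total f-recursive functions.                   *)

Definition pair (x y : nat) : nat := Cantor.to_nat (x, y).
Definition unpair1 (n : nat) : nat := fst (Cantor.of_nat n).
Definition unpair2 (n : nat) : nat := snd (Cantor.of_nat n).

Fixpoint prim_rec (g h : nat -> nat) (x n : nat) : nat :=
  match n with
  | O => g x
  | S m => h (pair (pair x m) (prim_rec g h x m))
  end.

Inductive rec_in (f : nat -> nat) : (nat -> nat) -> Prop :=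
| r_zero : rec_in f (fun _ => 0%nat)
| r_succ : rec_in f S
| r_fst : rec_in f unpair1
| r_snd : rec_in f unpair2
| r_oracle : rec_in f f
| r_pair : forall g h, rec_in f g -> rec_in f h ->
    rec_in f (fun n => pair (g n) (h n))
| r_comp : forall g h, rec_in f g -> rec_in f h ->
    rec_in f (fun n => g (h n))
| r_primrec : forall g h, rec_in f g -> rec_in f h ->
    rec_in f (fun p => prim_rec g h (unpair1 p) (unpair2 p))
| r_min : forall g m, rec_in f g ->
    (forall x, g (pair x (m x)) = 0%nat /\
               forall y, (y < m x)%nat -> g (pair x y) <> 0%nat) ->
    rec_in f m
| r_ext : forall g h, rec_in f g -> (forall n, g n = h n) -> rec_in f h.

Definition recursive (g : nat -> nat) : Prop := rec_in (fun _ => 0%nat) g.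

Fixpoint code (l : list nat) : nat :=
  match l with
  | [] => 0%nat
  | a :: l' => S (pair a (code l'))
  end.

Definition restr (x : nat -> nat) (n : nat) : list nat := map x (seq 0 n).
Definition b2n (b : bool) : nat := if b then 1%nat else 0%nat.
Definition restrb (x : nat -> bool) (n : nat) : list nat := restr (fun i => b2n (x i)) n.

Definition Sigma11_baire (A : (nat -> nat) -> Prop) : Prop :=
  exists R, recursive R /\
    forall x, A x <-> exists y : nat -> nat,
      forall n, R (pair (code (restr x n)) (code (restr y n))) = 0%nat.

Definition Sigma11_cantor (E : (nat -> bool) -> Prop) : Prop :=
  exists R, recursive R /\
    forall x, E x <-> exists y : nat -> nat,
      forall n, R (pair (code (restrb x n)) (code (restr y n))) = 0%nat.

Definition Pi01_in (f : nat -> nat) (C : (nat -> bool) -> Prop) : Prop :=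
  exists R, rec_in f R /\
    forall x, C x <-> forall n, R (code (restrb x n)) = 0%nat.

Definition Sigma11_basis (B : (nat -> nat) -> Prop) : Prop :=
  forall A, Sigma11_baire A -> (exists x, A x) -> exists x, A x /\ B x.

Definition Pi11_set (X : nat -> Prop) : Prop :=
  exists R, recursive R /\
    forall n, X n <-> forall y : nat -> nat, exists m,
      R (pair n (code (restr y m))) = 0%nat.

Definition Pi11_complete (X : nat -> Prop) : Prop :=
  Pi11_set X /\
  forall Y, Pi11_set Y -> exists g, recursive g /\ forall n, Y n <-> X (g n).

Definition char_fun (X : nat -> Prop) (o : nat -> nat) : Prop :=
  forall n, (X n -> o n = 1%nat) /\ (~ X n -> o n = 0%nat).

Definition cdist (x y : nat -> bool) (r : R) : Prop :=
  ((forall i, x i = y i) /\ r = 0) \/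
  (exists k, x k <> y k /\ (forall i, (i < k)%nat -> x i = y i) /\ r = / 2 ^ k).

(* diam_is U d : d = diam U = sup{d(x,y) : x,y in U}  (diam of empty set = 0) *)
Definition diam_is (U : (nat -> bool) -> Prop) (d : R) : Prop :=
  0 <= d /\
  (forall x y r, U x -> U y -> cdist x y r -> r <= d) /\
  (forall d', 0 <= d' -> (forall x y r, U x -> U y -> cdist x y r -> r <= d') -> d <= d').

Definition pow_s (s d : R) : R :=
  match Rle_dec d 0 with
  | left _ => 0
  | right _ => Rpower d s
  end.

(* v is the value sum_i diam(U_i)^s of some countable delta-cover (U_i) of E
   whose s-sum converges.  H^s_delta(E) is the infimum of these values
   (+infinity if there are none). *)
Definition Hs_delta_value (s delta : R) (E : (nat -> bool) -> Prop) (v : R) : Prop :=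
  exists (U : nat -> (nat -> bool) -> Prop) (d : nat -> R),
    (forall i, diam_is (U i) (d i)) /\
    (forall i, d i <= delta) /\
    (forall x, E x -> exists i, U i x) /\
    infinite_sum (fun i => pow_s s (d i)) v.

Definition Hs_delta_pos (s delta : R) (E : (nat -> bool) -> Prop) : Prop :=
  exists eps, 0 < eps /\ forall v, Hs_delta_value s delta E v -> eps <= v.

(* H^s(E) = sup_{delta>0} H^s_delta(E) > 0 *)
Definition Hs_pos (s : R) (E : (nat -> bool) -> Prop) : Prop :=
  exists delta, 0 < delta /\ Hs_delta_pos s delta E.

(* Main.v *)
Require Import Defs.
From Stdlib Require Import Reals List Arith Cantor.
From Stdlib Require Import Lia Lra Classical ClassicalEpsilon.
Import ListNotations.
Open Scope R_scope.

(* Replace [H^s] by the content in which a cylinder of length [n] costs a power of two close to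
   [2^(- n s)], with the same sets of positive measure. The content is continuous along
   increasing unions, so if [E] is the projection of a closed set and has
   content above [t], then one can choose bounds [g 0], [g 1], ... on the witnesses one at a time
   and keep the content above [t / 2] at every stage. Hence the compact set of those [x] that have
   a witness below [g] has positive content, which on every finite level shows in an integer
   valued function on strings, subadditive and dominated by the weights. The functions [f] that
   code such bounds, witnesses and lower bounds on content form a nonempty [Pi01] class,
   which the basis meets; Koenig's lemma shows that the tree coded by any such [f] has all its
   paths in [E] and positive content. *)

(** The content is finite on the whole space but only subadditive; [cov_increasing] is the
    substitute and the analytic core of the proof. The second obstacle is complexity: positive
    content is a statement about all covers. At a finite level, however, the content of a tree is
    the minimum cut of the binary tree with the weights as capacities, and a lower bound for it is
    certified by numbers that behave like a flow. Powers of two as weights make these comparisons of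
    naturals. Certificates consist of inequalities only, so whatever member the basis supplies will
    do, however far it is from the one constructed. *)

(** * Strings and cylinders *)

(* Finite strings are kept in reverse order, the last symbol at the head. *)
Fixpoint pre {X : Type} (x : nat -> X) (n : nat) : list X :=
  match n with
  | O => []
  | S m => x m :: pre x m
  end.

Definition cyl (s : list bool) (x : nat -> bool) : Prop := pre x (length s) = s.

Definition ext (u s : list bool) : Prop := exists l, s = l ++ u.

Lemma pre_length {X : Type} (x : nat -> X) n : length (pre x n) = n.
Proof. induction n; simpl; congruence. Qed.

Lemma pre_add {X : Type} (x : nat -> X) n m :
  exists l, length l = n /\ pre x (n + m) = l ++ pre x m.
Proof.
  induction n as [|n [l [Hl H]]].
  - exists []; auto.
  - exists (x (n + m)%nat :: l); simpl; rewrite H, Hl; auto.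
Qed.

Lemma cyl_pre x n : cyl (pre x n) x.
Proof. unfold cyl; now rewrite pre_length. Qed.

Lemma app_length_inj {X : Type} (a b c d : list X) :
  a ++ b = c ++ d -> length b = length d -> a = c /\ b = d.
Proof.
  revert c; induction a as [|h a IH]; intros [|h' c] H Hl; simpl in *; auto.
  - apply (f_equal (@length X)) in H; simpl in H; rewrite length_app in H; lia.
  - apply (f_equal (@length X)) in H; simpl in H; rewrite length_app in H; lia.
  - injection H as -> H. destruct (IH c H Hl); subst; auto.
Qed.

Lemma ext_refl u : ext u u.
Proof. now exists []. Qed.

Lemma ext_trans u v w : ext u v -> ext v w -> ext u w.
Proof. intros [l ->] [l' ->]; exists (l' ++ l); now rewrite app_assoc. Qed.

Lemma ext_length u s : ext u s -> (length u <= length s)%nat.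
Proof. intros [l ->]; rewrite length_app; lia. Qed.

Lemma ext_cons u s b : ext u s -> ext u (b :: s).
Proof. intros [l ->]; now exists (b :: l). Qed.

Lemma ext_nil s : ext [] s.
Proof. exists s; now rewrite app_nil_r. Qed.

Lemma ext_eq u s : ext u s -> (length s <= length u)%nat -> s = u.
Proof.
  intros [l ->] H; rewrite length_app in H; destruct l; simpl in *; auto; lia.
Qed.

Lemma ext_inv u s : ext u s -> s = u \/ exists b, ext (b :: u) s.
Proof.
  intros [l ->]. destruct l as [|b l _] using rev_ind; [now left|].
  right; exists b, l; now rewrite <- app_assoc.
Qed.

Lemma ext_comparable u v s :
  ext u s -> ext v s -> (length u <= length v)%nat -> ext u v.
Proof.
  intros [l ->] [m H] Hl.
  revert m H; induction l as [|h l IH]; intros [|h' m] H; simpl in *.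
  - subst; apply ext_refl.
  - subst; simpl in Hl; rewrite length_app in Hl; lia.
  - subst v; now exists (h :: l).
  - injection H as _ H; eauto.
Qed.

Lemma cyl_ext u s x : ext u s -> cyl s x -> cyl u x.
Proof.
  unfold cyl; intros [l ->]; rewrite length_app; intros H.
  destruct (pre_add x (length l) (length u)) as [l' [Hl' E]].
  rewrite E in H. apply app_length_inj in H; [tauto|apply pre_length].
Qed.

Lemma cyl_comparable u s x :
  cyl u x -> cyl s x -> (length u <= length s)%nat -> ext u s.
Proof.
  unfold cyl; intros Hu Hs Hl.
  replace (length s) with ((length s - length u) + length u)%nat in Hs by lia.
  destruct (pre_add x (length s - length u) (length u)) as [l [_ E]].
  exists l; congruence.
Qed.

Lemma cyl_child s x : cyl s x -> cyl (x (length s) :: s) x.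
Proof. unfold cyl; simpl; congruence. Qed.

Lemma pre_ext x y n : (forall i, (i < n)%nat -> x i = y i :> bool) -> pre x n = pre y n.
Proof.
  induction n; simpl; intros H; auto. rewrite H, IHn; auto.
Qed.

Lemma pre_inj (x y : nat -> bool) n :
  pre x n = pre y n -> forall i, (i < n)%nat -> x i = y i.
Proof.
  induction n; simpl; intros H i Hi; [lia|]. injection H as H1 H2.
  destruct (Nat.eq_dec i n); subst; auto. apply IHn; auto; lia.
Qed.

(** * Content of sets of strings *)

(** Turns undecidable predicates into Booleans, so that [filter] can split lists along them. *)
Definition classicb (P : Prop) : bool :=
  if excluded_middle_informative P then true else false.

Lemma classicb_true P : classicb P = true -> P.
Proof. unfold classicb; destruct excluded_middle_informative; intuition congruence. Qed.

Lemma classicb_intro (P : Prop) : P -> classicb P = true.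
Proof. unfold classicb; destruct excluded_middle_informative; intuition congruence. Qed.

Fixpoint rsum {X : Type} (F : X -> R) (l : list X) : R :=
  match l with
  | [] => 0
  | a :: l' => F a + rsum F l'
  end.

Lemma rsum_nonneg {X} (F : X -> R) l : (forall a, 0 <= F a) -> 0 <= rsum F l.
Proof. intros H; induction l; simpl; [lra|]. specialize (H a); lra. Qed.

Lemma rsum_filter {X} (F : X -> R) b l :
  rsum F l = rsum F (filter b l) + rsum F (filter (fun a => negb (b a)) l).
Proof. induction l; simpl; [lra|]. destruct (b a); simpl; lra. Qed.

Lemma rsum_filter_le {X} (F : X -> R) b l :
  (forall a, 0 <= F a) -> rsum F (filter b l) <= rsum F l.
Proof.
  intros H; rewrite (rsum_filter F b l).
  pose proof (rsum_nonneg F (filter (fun a => negb (b a)) l) H); lra.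
Qed.

Lemma rsum_filter2_le {X} (F : X -> R) b c d l :
  (forall a, 0 <= F a) ->
  (forall a, b a = true -> d a = true) -> (forall a, c a = true -> d a = true) ->
  (forall a, b a = true -> c a = true -> False) ->
  rsum F (filter b l) + rsum F (filter c l) <= rsum F (filter d l).
Proof.
  intros HF Hb Hc Hbc; induction l as [|a l IH]; simpl; [lra|].
  specialize (HF a); specialize (Hb a); specialize (Hc a); specialize (Hbc a).
  destruct (b a), (c a), (d a); simpl;
    try (exfalso; auto; fail);
    try (specialize (Hb eq_refl); discriminate);
    try (specialize (Hc eq_refl); discriminate); lra.
Qed.

Lemma rsum_app {X} (F : X -> R) l m : rsum F (l ++ m) = rsum F l + rsum F m.
Proof. induction l; simpl; lra. Qed.

Lemma rsum_scal {X} (F : X -> R) c l : rsum (fun a => c * F a) l = c * rsum F l.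
Proof. induction l; simpl; lra. Qed.

Definition weight (wt : nat -> R) : Prop :=
  (forall n, 0 < wt n) /\ (forall n, wt (S n) <= wt n).

Lemma weight_mono wt : weight wt -> forall n m, (n <= m)%nat -> wt m <= wt n.
Proof.
  intros [_ H] n m Hnm; induction Hnm; [lra|]. specialize (H m); lra.
Qed.

(** The sum over a possibly infinite [W] is bounded through its finite duplicate-free lists, which
    avoids enumerations and convergence. *)
Definition cost_le (wt : nat -> R) (W : list bool -> Prop) (t : R) : Prop :=
  forall l, NoDup l -> (forall s, In s l -> W s) -> rsum (fun s => wt (length s)) l <= t.

(** The content itself never appears as a real number: [cov wt A t] gives content at most [t], and
    its negation gives content at least [t]. The lengths of the strings are unrestricted, unlike in
    [Hs_delta_value]. *)
Definition cov (wt : nat -> R) (A : (nat -> bool) -> Prop) (t : R) : Prop :=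
  exists W, (forall x, A x -> exists s, W s /\ cyl s x) /\ cost_le wt W t.

Lemma cost_nonneg wt W t : cost_le wt W t -> 0 <= t.
Proof. intros H. apply (H []); [constructor|intros ? []]. Qed.

Lemma cov_nonneg wt A t : cov wt A t -> 0 <= t.
Proof. intros [W [_ H]]; eapply cost_nonneg; eauto. Qed.

Lemma cost_le_mono wt (W V : list bool -> Prop) t u :
  (forall s, V s -> W s) -> t <= u -> cost_le wt W t -> cost_le wt V u.
Proof.
  intros Hs Htu H l Hl HV. apply Rle_trans with t; auto.
Qed.

Lemma cov_mono wt (A B : (nat -> bool) -> Prop) t u :
  (forall x, B x -> A x) -> t <= u -> cov wt A t -> cov wt B u.
Proof.
  intros Hs Htu [W [HW Hc]]. exists W; split; [auto|].
  eapply cost_le_mono; eauto.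
Qed.

Lemma exists_nodup_choice {X I : Type} (W : I -> X -> Prop) (l : list X) :
  (forall s, In s l -> exists i, W i s) ->
  exists L, NoDup L /\ forall s, In s l -> exists i, In i L /\ W i s.
Proof.
  induction l as [|a l IH]; intros H.
  - exists []; split; [constructor|intros ? []].
  - destruct IH as [L [HL HL']]; [intros; apply H; now right|].
    destruct (H a (or_introl eq_refl)) as [i Hi].
    destruct (classic (In i L)) as [Hin|Hin].
    + exists L; split; auto. intros s [<-|Hs]; eauto.
    + exists (i :: L); split; [now constructor|].
      intros s [<-|Hs]; [exists i; simpl; auto|].
      destruct (HL' s Hs) as [j [? ?]]; exists j; simpl; auto.
Qed.

(** A finite list from the union meets only finitely many of the [W i]; its members in one [W i] are
    split off and charged to [c i], one index at a time. *)
Lemma cost_union wt {I : Type} (W : I -> list bool -> Prop) (c : I -> R) T :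
  (forall i, cost_le wt (W i) (c i)) ->
  (forall L, NoDup L -> rsum c L <= T) ->
  cost_le wt (fun s => exists i, W i s) T.
Proof.
  intros Hc HT l Hl Hin.
  destruct (exists_nodup_choice W l Hin) as [L [HL HLin]].
  apply Rle_trans with (rsum c L); auto. clear HT HL Hin.
  revert l Hl HLin; induction L as [|i L IH]; intros l Hl HLin.
  - destruct l as [|a l]; simpl; [lra|].
    destruct (HLin a (or_introl eq_refl)) as [i [[] _]].
  - rewrite (rsum_filter _ (fun s => classicb (W i s)) l). simpl.
    apply Rplus_le_compat.
    + apply (Hc i); [now apply NoDup_filter|].
      intros s Hs; apply filter_In in Hs; now apply classicb_true.
    + apply IH; [now apply NoDup_filter|].
      intros s Hs; apply filter_In in Hs as [Hs Hn].
      destruct (HLin s Hs) as [j [[<-|Hj] Hw]]; [|eauto].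
      apply classicb_intro in Hw; rewrite Hw in Hn; discriminate.
Qed.

Lemma cov_union wt {I : Type} (A : I -> (nat -> bool) -> Prop) (c : I -> R) T :
  (forall i, cov wt (A i) (c i)) ->
  (forall L, NoDup L -> rsum c L <= T) ->
  cov wt (fun x => exists i, A i x) T.
Proof.
  intros H HT.
  assert (exists W : I -> list bool -> Prop, forall i,
    (forall x, A i x -> exists s, W i s /\ cyl s x) /\ cost_le wt (W i) (c i)) as [W HW].
  { exists (fun i => proj1_sig (constructive_indefinite_description _ (H i))).
    intros i; exact (proj2_sig (constructive_indefinite_description _ (H i))). }
  exists (fun s => exists i, W i s); split.
  - intros x [i Hx]. destruct (proj1 (HW i) x Hx) as [s [? ?]]; eauto.
  - eapply cost_union; eauto. intros i; apply HW.
Qed.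

Lemma rsum_bool_le (c : bool -> R) L :
  (forall b, 0 <= c b) -> NoDup L -> rsum c L <= c true + c false.
Proof.
  intros Hc HL. pose proof (Hc true); pose proof (Hc false).
  destruct L as [|a [|b [|d L]]]; simpl; try lra.
  - destruct a; lra.
  - inversion HL as [|? ? Ha _]; destruct a, b; simpl in Ha; intuition lra.
  - inversion HL as [|? ? Ha HL']; inversion HL' as [|? ? Hb _].
    destruct a, b, d; simpl in *; intuition congruence.
Qed.

Lemma cov_union2 wt (A B C : (nat -> bool) -> Prop) a b :
  (forall x, C x -> A x \/ B x) -> cov wt A a -> cov wt B b -> cov wt C (a + b).
Proof.
  intros HC HA HB.
  apply cov_mono with (fun x => exists i : bool, (if i then A else B) x) (a + b); [|lra|].
  - intros x Hx; destruct (HC x Hx); [exists true|exists false]; auto.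
  - apply cov_union with (fun i : bool => if i then a else b).
    + intros []; auto.
    + intros L HL; apply (rsum_bool_le (fun i : bool => if i then a else b)); auto.
      intros []; eapply cov_nonneg; eauto.
Qed.

Lemma rsum_nat_geom e (L : list nat) :
  0 <= e -> NoDup L -> rsum (fun n => e * (/ 2) ^ S n) L <= e.
Proof.
  intros He HL.
  assert (H : forall N L, NoDup L -> (forall n, In n L -> (n < N)%nat) ->
    rsum (fun n => e * (/ 2) ^ S n) L <= e * (1 - (/ 2) ^ N)).
  { clear L HL; induction N as [|N IH]; intros L HL HN.
    - destruct L as [|n L]; simpl; [lra|]. exfalso; specialize (HN n (or_introl eq_refl)); lia.
    - assert (Hp : 0 <= e * (/ 2) ^ N) by (apply Rmult_le_pos; auto; apply pow_le; lra).
      destruct (classic (In N L)) as [Hin|Hin].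
      + apply in_split in Hin as [l1 [l2 ->]].
        apply NoDup_remove in HL as [HL Hn].
        assert (Hb : rsum (fun n => e * (/ 2) ^ S n) (l1 ++ l2) <= e * (1 - (/ 2) ^ N)).
        { apply IH; auto. intros n Hi. assert (n <> N) by congruence.
          assert (n < S N)%nat; [|lia]. apply HN. rewrite in_app_iff in *; simpl; tauto. }
        rewrite rsum_app in *; cbn [rsum pow] in *; lra.
      + assert (rsum (fun n => e * (/ 2) ^ S n) L <= e * (1 - (/ 2) ^ N)).
        { apply IH; auto. intros n Hi. assert (n <> N) by congruence.
          specialize (HN n Hi); lia. }
        change ((/ 2) ^ S N) with (/ 2 * (/ 2) ^ N); lra. }
  assert (exists N, forall n, In n L -> (n < N)%nat) as [N HN].
  { clear; induction L as [|a L [N HN]]; [exists O; intros ? []|].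
    exists (S (a + N)); intros n [<-|Hn]; [lia|]. specialize (HN n Hn); lia. }
  eapply Rle_trans; [apply (H N); eauto|].
  assert (0 <= e * (/ 2) ^ N) by (apply Rmult_le_pos; auto; apply pow_le; lra). lra.
Qed.

Lemma cov_union_null wt (A : nat -> (nat -> bool) -> Prop) :
  (forall n e, 0 < e -> cov wt (A n) e) ->
  forall e, 0 < e -> cov wt (fun x => exists n, A n x) e.
Proof.
  intros H e He. apply cov_union with (fun n => e * (/ 2) ^ S n).
  - intros n; apply H. apply Rmult_lt_0_compat; auto. apply pow_lt; lra.
  - intros L HL; apply rsum_nat_geom; auto; lra.
Qed.

Lemma cov_cyl wt s : weight wt -> cov wt (cyl s) (wt (length s)).
Proof.
  intros Hw. exists (eq s); split; [eauto|].
  intros l Hl Hin. pose proof (proj1 Hw (length s)).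
  destruct l as [|a [|b l]]; simpl; [lra| |].
  - rewrite <- (Hin a) by (now left); lra.
  - exfalso. pose proof (Hin a (or_introl eq_refl)).
    pose proof (Hin b (or_intror (or_introl eq_refl))). subst.
    inversion Hl as [|? ? Hn _]; apply Hn; now left.
Qed.

Lemma cov_empty wt (A : (nat -> bool) -> Prop) : (forall x, ~ A x) -> cov wt A 0.
Proof.
  intros H. exists (fun _ => False); split.
  - intros x Hx; destruct (H x Hx).
  - intros [|a l] _ Hin; simpl; [lra|]. destruct (Hin a); now left.
Qed.

(** * Increasing unions *)

(** Take for [t0] the supremum of the finite sums over [V0]. Lists from [V0] and [V1] are disjoint
    and concatenate to a list from [V], so [t - t0] bounds the sums over [V1]. *)
Lemma cost_split wt (V V0 V1 : list bool -> Prop) t :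
  cost_le wt V t -> (forall s, V0 s -> V s) -> (forall s, V1 s -> V s) ->
  (forall s, V0 s -> V1 s -> False) ->
  exists t0 t1, t0 + t1 <= t /\ cost_le wt V0 t0 /\ cost_le wt V1 t1.
Proof.
  intros H H0 H1 Hd.
  destruct (completeness (fun r => exists l, NoDup l /\ (forall s, In s l -> V0 s) /\
    r = rsum (fun s => wt (length s)) l)) as [t0 [Hub Hlub]].
  - exists t. intros r [l [Hl [Hin ->]]]. apply H; auto.
  - exists 0, []; repeat split; [constructor|intros ? []].
  - exists t0, (t - t0); split; [lra|]; split.
    + intros l Hl Hin. apply Hub; eauto.
    + intros l Hl Hin.
      assert (t0 <= t - rsum (fun s => wt (length s)) l); [|lra].
      apply Hlub. intros r [l' [Hl' [Hin' ->]]].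
      enough (rsum (fun s => wt (length s)) (l' ++ l) <= t) by (rewrite rsum_app in *; lra).
      apply H.
      * apply NoDup_app; auto. intros a Ha Hb; eauto.
      * intros s Hs; apply in_app_iff in Hs as [|]; auto.
Qed.

(* Since [t] is smaller than the weight of [u], the cover contains no prefix of [u],
   so it splits into covers of the two halves. *)
Lemma cov_split wt (A : (nat -> bool) -> Prop) u t :
  weight wt -> cov wt (fun x => A x /\ cyl u x) t -> t < wt (length u) ->
  exists t0 t1, t0 + t1 <= t /\ cov wt (fun x => A x /\ cyl (false :: u) x) t0 /\
    cov wt (fun x => A x /\ cyl (true :: u) x) t1.
Proof.
  intros Hw [V [HV Hc]] Ht.
  assert (Hchild : forall b x, A x -> cyl (b :: u) x -> exists s, (V s /\ ext (b :: u) s) /\ cyl s x).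
  { intros b x Hx Hu. destruct (HV x) as [s [Hs Hsx]].
    { split; auto. apply cyl_ext with (b :: u); auto. exists [b]; auto. }
    exists s; repeat split; auto. apply (cyl_comparable _ _ x); auto.
    destruct (le_lt_dec (length (b :: u)) (length s)) as [|Hlt]; auto. exfalso.
    assert (wt (length s) <= t).
    { specialize (Hc [s]); simpl in Hc; rewrite Rplus_0_r in Hc. apply Hc.
      - repeat constructor; intros [].
      - intros ? [<-|[]]; auto. }
    pose proof (weight_mono wt Hw (length s) (length u)). simpl in Hlt.
    assert (wt (length u) <= wt (length s)) by (apply H0; lia). lra. }
  destruct (cost_split wt V (fun s => V s /\ ext (false :: u) s) (fun s => V s /\ ext (true :: u) s) t)
    as [t0 [t1 [Hle [H0 H1]]]]; auto; try tauto.
  { intros s [_ Ha] [_ Hb]. apply (ext_comparable _ _ _ Ha) in Hb; [|simpl; lia].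
    apply ext_eq in Hb; [discriminate|simpl; lia]. }
  exists t0, t1; split; auto; split; (eexists; split; [|eassumption]);
    intros x [? ?]; apply Hchild; auto.
Qed.

(** Replacing each string of a cover by a cover of the part of [N] in its cylinder multiplies the
    total cost by [r]. Iteration starts from the cover by the empty string. *)
Lemma cov_all_shrink wt (N : (nat -> bool) -> Prop) r :
  weight wt -> 0 <= r < 1 ->
  (forall s, cov wt (fun x => N x /\ cyl s x) (r * wt (length s))) ->
  forall e, 0 < e -> cov wt N e.
Proof.
  intros Hw Hr H.
  assert (Hstep : forall t, cov wt N t -> cov wt N (r * t)).
  { intros t [W [HW Hc]].
    apply cov_mono with (fun x => exists i, W i /\ N x /\ cyl i x) (r * t); [|lra|].
    { intros x Hx; destruct (HW x Hx) as [s [? ?]]; eauto. }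
    apply cov_union with (fun i => if classicb (W i) then r * wt (length i) else 0).
    - intros i; unfold classicb; destruct excluded_middle_informative.
      + eapply cov_mono; [|apply Rle_refl|apply H]; tauto.
      + apply cov_empty; tauto.
    - intros L HL.
      replace (rsum (fun i => if classicb (W i) then r * wt (length i) else 0) L)
        with (r * rsum (fun s => wt (length s)) (filter (fun i => classicb (W i)) L)).
      + apply Rmult_le_compat_l; [lra|]. apply Hc; [now apply NoDup_filter|].
        intros s Hs; apply filter_In in Hs; now apply classicb_true.
      + clear; induction L; simpl; [lra|]. destruct (classicb (W a)); simpl; lra. }
  assert (Hk : forall k, cov wt N (r ^ k * wt 0%nat)).
  { induction k; simpl.
    - rewrite Rmult_1_l. apply cov_mono with (cyl []) (wt 0%nat); [reflexivity|lra|].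
      apply (cov_cyl wt []); auto.
    - rewrite Rmult_assoc; auto. }
  intros e He. pose proof (proj1 Hw 0%nat) as H0.
  destruct (pow_lt_1_zero r) with (y := e / wt 0%nat) as [k Hk'].
  { rewrite Rabs_pos_eq; lra. }
  { apply Rdiv_lt_0_compat; auto. }
  apply cov_mono with N (r ^ k * wt 0%nat); auto.
  specialize (Hk' k (Nat.le_refl _)). rewrite Rabs_pos_eq in Hk' by (apply pow_le; lra).
  apply Rmult_le_reg_r with (/ wt 0%nat); [now apply Rinv_0_lt_compat|].
  rewrite Rmult_assoc, Rinv_r by lra. unfold Rdiv in Hk'; lra.
Qed.

Lemma minimal_length (P : list bool -> Prop) s :
  P s -> exists u, P u /\ ext u s /\ forall v, P v -> ext v u -> v = u.
Proof.
  remember (length s) as n eqn:Hn. revert s Hn.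
  induction n as [n IH] using lt_wf_ind; intros s Hn Hs.
  destruct (classic (forall v, P v -> ext v s -> v = s)) as [H|H].
  - exists s; repeat split; auto; apply ext_refl.
  - apply not_all_ex_not in H as [v Hv].
    apply imply_to_and in Hv as [Hv1 Hv2]. apply imply_to_and in Hv2 as [Hv2 Hv3].
    assert (length v < length s)%nat.
    { pose proof (ext_length _ _ Hv2). destruct (Nat.eq_dec (length v) (length s)); [|lia].
      exfalso; apply Hv3. symmetry; apply ext_eq; auto; lia. }
    destruct (IH (length v)) with (s := v) as [u [? [? ?]]]; auto; [lia|].
    exists u; repeat split; auto. eapply ext_trans; eauto.
Qed.

(** Content is not additive over the two children of [u], but a cover cheaper than [wt (length u)]
    splits between them. Proper prefixes of members of [l] are good, so a cover that is too
    expensive can be exchanged for one of cost [r * wt (length u)]. The descent distributes [t]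
    among the members of [l], each of which uses up more than [r] times its weight. *)
Lemma cost_antichain wt (A : (nat -> bool) -> Prop) (G W : list bool -> Prop) r :
  weight wt -> 0 <= r < 1 ->
  (forall s, G s -> cov wt (fun x => A x /\ cyl s x) (r * wt (length s))) ->
  (forall s u, W s -> ext u s -> u <> s -> G u) ->
  (forall s, W s -> ~ G s) ->
  forall d u t l, NoDup l -> (forall s, In s l -> W s /\ ext u s /\ (length s <= length u + d)%nat /\
      ~ cov wt (fun x => A x /\ cyl s x) (r * wt (length s))) ->
    cov wt (fun x => A x /\ cyl u x) t ->
    r * rsum (fun s => wt (length s)) l <= t.
Proof.
  intros Hw Hr HG HW HWG. induction d as [d IH] using lt_wf_ind; intros u t l Hl Hin Hcov.
  (* If [u] is in [l], it is the only member: any other would make [u] a proper prefix of a string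
     in [W], hence good. *)
  destruct (classic (In u l)) as [Hu|Hu].
  - assert (l = [u]) as ->.
    { assert (He : forall s, In s l -> s = u).
      { intros s Hs. destruct (classic (u = s)) as [|Hne]; [auto|exfalso].
        apply (HWG u); [now apply Hin|]. destruct (Hin s Hs) as [? [? _]]; eauto. }
      destruct l as [|a [|b l]]; [destruct Hu| |].
      - f_equal; apply He; now left.
      - exfalso. inversion Hl as [|? ? Hn _]; apply Hn; left.
        rewrite (He a), (He b); simpl; auto. }
    destruct (Hin u Hu) as [_ [_ [_ Hn]]]. simpl. rewrite Rplus_0_r.
    apply Rnot_lt_le; intros Hlt. apply Hn. eapply cov_mono; [|apply Rlt_le, Hlt|eauto]; auto.
  - destruct l as [|a l].
    { simpl; rewrite Rmult_0_r; eapply cov_nonneg; eauto. }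
    assert (HGu : G u).
    { destruct (Hin a (or_introl eq_refl)) as [Ha [Hext _]].
      apply (HW a); auto. intros ->; apply Hu; now left. }
    destruct d as [|d].
    { exfalso; apply Hu. destruct (Hin a (or_introl eq_refl)) as [_ [Hext [Hlen _]]].
      left. apply ext_eq; auto; lia. }
    remember (a :: l) as k eqn:Ek; clear a l Ek.
    assert (exists t', t' <= t /\ t' < wt (length u) /\ cov wt (fun x => A x /\ cyl u x) t')
      as [t' [Ht [Htu Hc]]].
    { destruct (Rlt_le_dec t (wt (length u))) as [Hlt|Hge]; [exists t; repeat split; auto; lra|].
      pose proof (proj1 Hw (length u)).
      exists (r * wt (length u)); repeat split; auto; nra. }
    destruct (cov_split wt A u t' Hw Hc Htu) as [t0 [t1 [Hle [H0 H1]]]].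
    set (b := fun s => classicb (ext (false :: u) s)).
    assert (Hf : r * rsum (fun s => wt (length s)) (filter b k) <= t0).
    { apply (IH d) with (u := false :: u); auto; [now apply NoDup_filter|].
      intros s Hs; apply filter_In in Hs as [Hs Hb]. apply classicb_true in Hb.
      destruct (Hin s Hs) as [? [? [? ?]]]. repeat split; auto. simpl; lia. }
    assert (Ht' : r * rsum (fun s => wt (length s)) (filter (fun s => negb (b s)) k) <= t1).
    { apply (IH d) with (u := true :: u); auto; [now apply NoDup_filter|].
      intros s Hs; apply filter_In in Hs as [Hs Hb].
      destruct (Hin s Hs) as [? [He [? ?]]]. repeat split; auto; [|simpl; lia].
      destruct (ext_inv _ _ He) as [->|[[] Hf']]; auto; [contradiction|].
      unfold b in Hb. apply classicb_intro in Hf'. rewrite Hf' in Hb; discriminate. }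
    rewrite (rsum_filter _ b k). lra.
Qed.

(* Call [s] good if every [A n] has content at most [r * wt s] in the cylinder of [s]. The minimal
   strings that are not good cost at most [a / r]; off them every string is good, which by
   [cov_all_shrink] leaves only null sets. *)
Lemma cov_increasing_scaled wt (A : nat -> (nat -> bool) -> Prop) a r :
  weight wt -> 0 < r < 1 ->
  (forall n m x, (n <= m)%nat -> A n x -> A m x) ->
  (forall n, cov wt (A n) a) ->
  forall e, 0 < e -> cov wt (fun x => exists n, A n x) (a / r + e).
Proof.
  intros Hw Hr Hmono Ha e He.
  set (G := fun s => forall n, cov wt (fun x => A n x /\ cyl s x) (r * wt (length s))).
  set (W := fun s => ~ G s /\ forall u, ~ G u -> ext u s -> u = s).
  assert (HcW : cost_le wt W (a / r)).
  { intros l Hl HW.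
    (* Finitely many bad strings are bad at a common stage, since the [A n] increase. *)
    assert (exists n, forall s, In s l -> ~ cov wt (fun x => A n x /\ cyl s x) (r * wt (length s)))
      as [n Hn].
    { clear Hl; induction l as [|s l IH]; [exists O; intros ? []|].
      destruct IH as [n Hn]; [intros; apply HW; now right|].
      destruct (HW s (or_introl eq_refl)) as [HG _].
      apply not_all_ex_not in HG as [m Hm].
      exists (n + m)%nat. intros s' Hs Hc.
      assert (forall k, (k <= n + m)%nat -> cov wt (fun x => A k x /\ cyl s' x) (r * wt (length s'))) as Hk.
      { intros k Hk. eapply cov_mono; [|apply Rle_refl|exact Hc]. simpl. intros x [? ?]; split; eauto. }
      destruct Hs as [<-|Hs]; [apply Hm, Hk; lia|apply (Hn s' Hs), Hk; lia]. }
    assert (exists d, forall s, In s l -> (length s <= d)%nat) as [d Hd].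
    { clear; induction l as [|s l [d Hd]]; [exists O; intros ? []|].
      exists (length s + d)%nat; intros u [<-|Hu]; [lia|]. specialize (Hd u Hu); lia. }
    apply Rmult_le_reg_l with r; [lra|]. replace (r * (a / r)) with a by (field; lra).
    apply (cost_antichain wt (A n) G W r Hw) with (d := d) (u := []); auto; try lra.
    - intros s u [_ Hs] Hu Hne. apply NNPP; intros HG; apply Hne; auto.
    - intros s [? _]; auto.
    - intros s Hs. split; [now apply HW|split; [apply ext_nil|split; [simpl|]; auto]].
    - eapply cov_mono; [|apply Rle_refl|apply (Ha n)]; tauto. }
  apply cov_union2 with (fun x => exists s, W s /\ cyl s x)
    (fun x => exists n, A n x /\ forall s, W s -> ~ cyl s x).
  - intros x [n Hx]. destruct (classic (exists s, W s /\ cyl s x)); [tauto|].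
    right; exists n; split; auto. intros s Hs Hc; eauto.
  - exists W; auto.
  (* Below a string of [W] the remaining set is empty; any other string is good, for otherwise a
     minimal bad prefix of it would lie in [W]. *)
  - apply cov_union_null; auto. intros n. apply cov_all_shrink with r; auto; [lra|].
    intros s. destruct (classic (exists u, W u /\ ext u s)) as [[u [Hu Hus]]|HnW].
    + apply cov_mono with (fun _ : nat -> bool => False) 0.
      * intros x [[_ Hx] Hs]. apply (Hx u Hu). eapply cyl_ext; eauto.
      * pose proof (proj1 Hw (length s)); nra.
      * apply cov_empty; auto.
    + assert (G s) as HG.
      { apply NNPP; intros HG.
        destruct (minimal_length (fun s => ~ G s) s HG) as [u [? [? ?]]].
        apply HnW; exists u; unfold W; auto. }
      eapply cov_mono; [|apply Rle_refl|apply (HG n)]; simpl; tauto.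
Qed.

Lemma cov_increasing wt (A : nat -> (nat -> bool) -> Prop) a :
  weight wt ->
  (forall n m x, (n <= m)%nat -> A n x -> A m x) ->
  (forall n, cov wt (A n) a) ->
  forall e, 0 < e -> cov wt (fun x => exists n, A n x) (a + e).
Proof.
  intros Hw Hm Ha e He. pose proof (cov_nonneg _ _ _ (Ha 0%nat)).
  (* Close enough to 1 for [a / r <= a + e / 2]; the term [e / 4] keeps [r] positive when
     [a = 0]. *)
  set (r := (a + e / 4) / (a + e / 2)).
  assert (Hr : 0 < r < 1).
  { unfold r; split; [apply Rdiv_lt_0_compat; lra|].
    apply Rmult_lt_reg_r with (a + e / 2); [lra|]. unfold Rdiv at 1.
    rewrite Rmult_assoc, Rinv_l by lra. lra. }
  apply cov_mono with (fun x => exists n, A n x) (a / r + e / 4); auto.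
  - assert (a / r <= a + e / 2); [|lra].
    apply Rmult_le_reg_r with r; [lra|]. replace (a / r * r) with a by (field; lra).
    unfold r. replace ((a + e / 2) * ((a + e / 4) / (a + e / 2))) with (a + e / 4) by (field; lra). lra.
  - apply cov_increasing_scaled; auto; lra.
Qed.

Open Scope nat_scope.

(** * Recursive functions *)

Lemma unpair1_pair x y : unpair1 (pair x y) = x.
Proof. unfold unpair1, pair; now rewrite Cantor.cancel_of_to. Qed.

Lemma unpair2_pair x y : unpair2 (pair x y) = y.
Proof. unfold unpair2, pair; now rewrite Cantor.cancel_of_to. Qed.

Lemma pair_unpair n : pair (unpair1 n) (unpair2 n) = n.
Proof.
  unfold pair, unpair1, unpair2. rewrite <- surjective_pairing. apply Cantor.cancel_to_of.
Qed.

Lemma le_pair x y : y + x <= pair x y.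
Proof. apply Cantor.to_nat_non_decreasing. Qed.

Lemma rec_const o k : rec_in o (fun _ => k).
Proof.
  induction k as [|k IH]; [constructor|].
  apply (r_comp o S (fun _ => k)); [constructor|auto].
Qed.

Lemma rec_id o : rec_in o (fun n => n).
Proof.
  apply r_ext with (fun n => pair (unpair1 n) (unpair2 n)); [|apply pair_unpair].
  apply r_pair; constructor.
Qed.

Lemma rec_S o a : rec_in o a -> rec_in o (fun n => S (a n)).
Proof. apply (r_comp o S); constructor. Qed.

Lemma rec_unpair1 o a : rec_in o a -> rec_in o (fun n => unpair1 (a n)).
Proof. apply (r_comp o unpair1); constructor. Qed.

Lemma rec_unpair2 o a : rec_in o a -> rec_in o (fun n => unpair2 (a n)).
Proof. apply (r_comp o unpair2); constructor. Qed.

Lemma recursive_rec_in o g : recursive g -> rec_in o g.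
Proof.
  intros H; induction H.
  - apply r_zero.
  - apply r_succ.
  - apply r_fst.
  - apply r_snd.
  - apply r_zero.
  - now apply r_pair.
  - now apply r_comp.
  - now apply r_primrec.
  - now apply r_min with g.
  - now apply r_ext with g.
Qed.

Lemma rec_in_trans o f g : rec_in o f -> rec_in f g -> rec_in o g.
Proof.
  intros Hf H; induction H; auto.
  - apply r_zero.
  - apply r_succ.
  - apply r_fst.
  - apply r_snd.
  - now apply r_pair.
  - now apply r_comp.
  - now apply r_primrec.
  - now apply r_min with g.
  - now apply r_ext with g.
Qed.

Definition rec2 (o : nat -> nat) (g : nat -> nat -> nat) : Prop :=
  rec_in o (fun n => g (unpair1 n) (unpair2 n)).

Lemma rec_comp2 o g a b :
  rec2 o g -> rec_in o a -> rec_in o b -> rec_in o (fun n => g (a n) (b n)).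
Proof.
  intros Hg Ha Hb.
  apply r_ext with (fun n => (fun n => g (unpair1 n) (unpair2 n)) (pair (a n) (b n))).
  - apply (r_comp o (fun n => g (unpair1 n) (unpair2 n))); auto. now apply r_pair.
  - intros n; cbv beta; now rewrite unpair1_pair, unpair2_pair.
Qed.

Lemma rec_prim_rec o g h a b :
  rec_in o g -> rec_in o h -> rec_in o a -> rec_in o b ->
  rec_in o (fun n => prim_rec g h (a n) (b n)).
Proof. intros; apply rec_comp2; auto. now apply r_primrec. Qed.

Lemma rec_iter o g a b :
  rec_in o g -> rec_in o a -> rec_in o b ->
  rec_in o (fun n => Nat.iter (a n) g (b n)).
Proof.
  intros Hg Ha Hb.
  apply r_ext with (fun n => prim_rec (fun x => x) (fun p => g (unpair2 p)) (b n) (a n)).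
  - apply rec_prim_rec; auto; [apply rec_id|].
    apply (r_comp o g); auto; apply r_snd.
  - intros n. generalize (a n); intros k; induction k as [|k IH]; simpl; auto.
    now rewrite unpair2_pair, IH.
Qed.

Lemma rec_pred o a : rec_in o a -> rec_in o (fun n => pred (a n)).
Proof.
  intros Ha.
  apply r_ext with (fun n => prim_rec (fun _ => 0) (fun p => unpair2 (unpair1 p)) 0 (a n)).
  - apply rec_prim_rec; auto; try apply rec_const.
    apply rec_unpair2, r_fst.
  - intros n; destruct (a n); simpl; auto. now rewrite unpair1_pair, unpair2_pair.
Qed.

Lemma rec_add o a b : rec_in o a -> rec_in o b -> rec_in o (fun n => a n + b n).
Proof.
  intros Ha Hb. apply r_ext with (fun n => Nat.iter (a n) S (b n)).
  - apply rec_iter; auto; apply r_succ.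
  - intros n; induction (a n); simpl; auto.
Qed.

Lemma rec_sub o a b : rec_in o a -> rec_in o b -> rec_in o (fun n => a n - b n).
Proof.
  intros Ha Hb. apply r_ext with (fun n => Nat.iter (b n) pred (a n)).
  - apply rec_iter; auto. apply (rec_pred o (fun n => n)), rec_id.
  - intros n; induction (b n); simpl; lia.
Qed.

Lemma rec_mul o a b : rec_in o a -> rec_in o b -> rec_in o (fun n => a n * b n).
Proof.
  intros Ha Hb.
  apply r_ext with (fun n =>
    prim_rec (fun _ => 0) (fun p => unpair2 p + unpair1 (unpair1 p)) (b n) (a n)).
  - apply rec_prim_rec; auto; [apply rec_const|].
    apply rec_add; [apply r_snd|apply rec_unpair1, r_fst].
  - intros n; induction (a n) as [|k IH]; simpl; auto.
    rewrite unpair1_pair, unpair2_pair, unpair1_pair, IH; lia.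
Qed.

Lemma rec_pow o k b : rec_in o b -> rec_in o (fun n => k ^ b n).
Proof.
  intros Hb. apply r_ext with (fun n => Nat.iter (b n) (fun m => k * m) 1).
  - apply rec_iter; auto; try apply rec_const.
    apply rec_mul; [apply rec_const|apply rec_id].
  - intros n; induction (b n); simpl; auto.
Qed.

Definition ifz (c a b : nat) : nat := match c with O => a | S _ => b end.

Lemma rec_ifz o c a b :
  rec_in o c -> rec_in o a -> rec_in o b -> rec_in o (fun n => ifz (c n) (a n) (b n)).
Proof.
  intros Hc Ha Hb.
  apply r_ext with (fun n =>
    prim_rec unpair1 (fun p => unpair2 (unpair1 (unpair1 p))) (pair (a n) (b n)) (c n)).
  - apply rec_prim_rec; auto; [apply r_fst| |now apply r_pair].
    apply rec_unpair2, rec_unpair1, r_fst.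
  - intros n; destruct (c n); simpl.
    + apply unpair1_pair.
    + now rewrite !unpair1_pair, unpair2_pair.
Qed.

Create HintDb recdb.
#[export] Hint Resolve rec_const rec_id rec_S rec_unpair1 rec_unpair2 rec_pred rec_add rec_sub
  rec_mul rec_pow rec_ifz r_pair rec_iter r_fst r_snd r_succ : recdb.

(** * Codes of lists *)

Definition tl_code (c : nat) : nat := unpair2 (pred c).
Definition hd_code (c : nat) : nat := unpair1 (pred c).

Lemma rec_tl o a : rec_in o a -> rec_in o (fun n => tl_code (a n)).
Proof. intros; unfold tl_code; auto with recdb. Qed.

Lemma rec_hd o a : rec_in o a -> rec_in o (fun n => hd_code (a n)).
Proof. intros; unfold hd_code; auto with recdb. Qed.

Lemma hd_code_cons a l : hd_code (code (a :: l)) = a.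
Proof. unfold hd_code; simpl; apply unpair1_pair. Qed.

Lemma tl_code_code l : tl_code (code l) = code (tl l).
Proof. destruct l; [reflexivity|]. unfold tl_code; simpl; apply unpair2_pair. Qed.

Lemma iter_tl_code i l : Nat.iter i tl_code (code l) = code (skipn i l).
Proof.
  revert l; induction i as [|i IH]; intros l; [reflexivity|].
  rewrite Nat.iter_succ_r, tl_code_code, IH. destruct l; simpl; auto. now rewrite skipn_nil.
Qed.

Lemma length_le_code l : length l <= code l.
Proof. induction l; simpl; auto. pose proof (le_pair a (code l)); lia. Qed.

Fixpoint decode_fuel (k c : nat) : list nat :=
  match k, c with
  | S k', S c' => unpair1 c' :: decode_fuel k' (unpair2 c')
  | _, _ => []
  end.

(** The tail of a nonempty list has a smaller code, so [c] is enough fuel for itself. *)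
Definition decode (c : nat) : list nat := decode_fuel c c.

Lemma decode_fuel_code k l : code l <= k -> decode_fuel k (code l) = l.
Proof.
  revert l; induction k as [|k IH]; intros [|a l] H; simpl in *; auto; [lia|].
  pose proof (le_pair a (code l)). rewrite unpair1_pair, unpair2_pair, IH; auto; lia.
Qed.

Lemma decode_code l : decode (code l) = l.
Proof. now apply decode_fuel_code. Qed.

Lemma code_surj c : exists l, code l = c.
Proof.
  induction c as [c IH] using lt_wf_ind. destruct c as [|c]; [now exists []|].
  destruct (IH (unpair2 c)) as [l Hl].
  - pose proof (le_pair (unpair1 c) (unpair2 c)). rewrite pair_unpair in H; lia.
  - exists (unpair1 c :: l); simpl; now rewrite Hl, pair_unpair.
Qed.

Definition len (c : nat) : nat := length (decode c).

Lemma len_code l : len (code l) = length l.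
Proof. unfold len; now rewrite decode_code. Qed.

Lemma rec_len o a : rec_in o a -> rec_in o (fun n => len (a n)).
Proof.
  (* The length is the least number of tails that leaves the code 0 of the empty list. *)
  apply (r_comp o len). apply r_min with (fun p => Nat.iter (unpair2 p) tl_code (unpair1 p)).
  - apply rec_iter; auto with recdb. apply rec_tl, rec_id.
  - intros x; destruct (code_surj x) as [l <-]. rewrite len_code, unpair1_pair, unpair2_pair. split.
    + now rewrite iter_tl_code, skipn_all.
    + intros y Hy. rewrite unpair1_pair, unpair2_pair, iter_tl_code.
      destruct (skipn y l) eqn:E; [|discriminate].
      apply (f_equal (@length nat)) in E. rewrite length_skipn in E; simpl in E; lia.
Qed.

(** The state pairs the accumulator with the rest of the input. The step idles once the rest is
    empty, so the code of the input, which is at least its length, can serve as the number of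
    iterations. *)
Definition rev_step (f : nat -> nat) (p : nat) : nat :=
  ifz (unpair2 p) p
    (pair (S (pair (f (hd_code (unpair2 p))) (unpair1 p))) (tl_code (unpair2 p))).

Definition rev_map_code (f : nat -> nat) (c d : nat) : nat :=
  unpair1 (Nat.iter c (rev_step f) (pair d c)).

Lemma iter_rev_step f k l acc :
  length l <= k ->
  Nat.iter k (rev_step f) (pair (code acc) (code l)) = pair (code (rev_append (map f l) acc)) 0.
Proof.
  revert l acc; induction k as [|k IH]; intros [|a l] acc H; simpl length in H; try lia; auto.
  - rewrite Nat.iter_succ_r. unfold rev_step at 2. rewrite unpair2_pair. simpl ifz.
    change 0 with (code []). rewrite IH; simpl; auto; lia.
  - rewrite Nat.iter_succ_r. unfold rev_step at 2. rewrite !unpair2_pair, unpair1_pair.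
    rewrite hd_code_cons, tl_code_code. simpl ifz.
    change (S (pair (f a) (code acc))) with (code (f a :: acc)).
    rewrite IH; [reflexivity|simpl; lia].
Qed.

Lemma rev_map_code_code f l m :
  rev_map_code f (code l) (code m) = code (rev (map f l) ++ m).
Proof.
  unfold rev_map_code. rewrite iter_rev_step by apply length_le_code.
  now rewrite unpair1_pair, rev_append_rev.
Qed.

Lemma rec_rev_map o f a b :
  rec_in o f -> rec_in o a -> rec_in o b -> rec_in o (fun n => rev_map_code f (a n) (b n)).
Proof.
  intros Hf Ha Hb. unfold rev_map_code.
  apply rec_unpair1, rec_iter; auto; [|now apply r_pair].
  unfold rev_step.
  apply rec_ifz; [apply r_snd|apply rec_id|].
  apply r_pair; [|apply rec_tl, r_snd].
  apply rec_S, r_pair; [|apply r_fst].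
  apply (r_comp o f); auto. apply rec_hd, r_snd.
Qed.

Definition rev_code (c : nat) : nat := rev_map_code (fun n => n) c 0.
Definition map_code (f : nat -> nat) (c : nat) : nat := rev_code (rev_map_code f c 0).

Lemma rev_code_code l : rev_code (code l) = code (rev l).
Proof.
  unfold rev_code. change 0 with (code []). now rewrite rev_map_code_code, map_id, app_nil_r.
Qed.

Lemma map_code_code f l : map_code f (code l) = code (map f l).
Proof.
  unfold map_code. change 0 with (code []).
  now rewrite rev_map_code_code, app_nil_r, rev_code_code, rev_involutive.
Qed.

Lemma rec_rev o a : rec_in o a -> rec_in o (fun n => rev_code (a n)).
Proof. intros; apply rec_rev_map; auto with recdb. Qed.

Lemma rec_map o f a : rec_in o f -> rec_in o a -> rec_in o (fun n => map_code f (a n)).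
Proof. intros; apply rec_rev, rec_rev_map; auto with recdb. Qed.

#[export] Hint Resolve rec_tl rec_hd rec_len rec_rev : recdb.

Lemma rec_iter_tl o a b :
  rec_in o a -> rec_in o b -> rec_in o (fun n => Nat.iter (a n) tl_code (b n)).
Proof. intros; apply rec_iter; auto with recdb. Qed.

Lemma skipn_restr x m i :
  i < m -> skipn i (restr x m) = x i :: skipn (S i) (restr x m).
Proof.
  intros H; unfold restr. rewrite !skipn_map, !skipn_seq.
  destruct (m - i) as [|k] eqn:E; [lia|]. replace (m - S i) with k by lia.
  simpl; do 3 f_equal; lia.
Qed.

Lemma restr_length x m : length (restr x m) = m.
Proof. unfold restr; now rewrite length_map, length_seq. Qed.

Lemma restr_S x m : restr x (S m) = restr x m ++ [x m].
Proof. unfold restr; now rewrite seq_S, map_app. Qed.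

(** * Arithmetic in an oracle *)

(* Each of the conditions consults the oracle at three places given in advance, so it is decided
   by a finite initial segment of [f] found by table lookup; functionals in general are avoided. *)
Definition query_class (A : (nat -> nat) -> Prop) : Prop :=
  exists G a b c, recursive G /\ recursive a /\ recursive b /\ recursive c /\
    forall f, A f <-> forall n, G (pair n (pair (f (a n)) (pair (f (b n)) (f (c n))))) = 0.

(** A segment of length [m] tests condition number [unpair1 m] and passes if it is too short to
    contain the three places. Every condition is named by arbitrarily large [m], so all of them get
    tested; the witness sequence is a dummy. *)
Lemma query_class_Sigma11 A : query_class A -> Sigma11_baire A.
Proof.
  intros [G [a [b [c [HG [Ha [Hb [Hc HA]]]]]]]].
  set (look := fun i u => Nat.iter i tl_code u).
  (* Nonempty lists have successor codes, so [look] returns 0 exactly at places beyond the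
     segment. *)
  set (G' := fun n u =>
    ifz (look (a n) u) 0 (ifz (look (b n) u) 0 (ifz (look (c n) u) 0
      (G (pair n (pair (hd_code (look (a n) u))
           (pair (hd_code (look (b n) u)) (hd_code (look (c n) u))))))))).
  assert (Hlook : forall f m i, i < m -> exists k,
            look i (code (restr f m)) = S k /\ hd_code (look i (code (restr f m))) = f i).
  { intros f m i Hi. unfold look. rewrite iter_tl_code, skipn_restr by auto.
    eexists; split; [reflexivity|apply hd_code_cons]. }
  assert (Hlook0 : forall f m i, m <= i -> look i (code (restr f m)) = 0).
  { intros f m i Hi. unfold look. rewrite iter_tl_code, skipn_all2; auto.
    now rewrite restr_length. }
  exists (fun p => G' (unpair1 (len (unpair1 p))) (unpair1 p)). split.
  - unfold recursive, G', look in *.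
    assert (Hn : rec_in (fun _ => 0) (fun p => unpair1 (len (unpair1 p)))) by auto with recdb.
    pose proof (r_comp _ _ _ Ha Hn) as Ha'. pose proof (r_comp _ _ _ Hb Hn) as Hb'.
    pose proof (r_comp _ _ _ Hc Hn) as Hc'. cbv beta in Ha', Hb', Hc'.
    pose proof (rec_iter_tl _ _ _ Ha' (r_fst _)). pose proof (rec_iter_tl _ _ _ Hb' (r_fst _)).
    pose proof (rec_iter_tl _ _ _ Hc' (r_fst _)).
    repeat (apply rec_ifz; auto with recdb).
    apply (r_comp _ G); auto 8 with recdb.
  - intros f. rewrite HA. split.
    + intros H. exists (fun _ => 0). intros m. rewrite unpair1_pair, len_code, restr_length.
      unfold G'. set (n := unpair1 m).
      destruct (le_lt_dec m (a n)) as [|La]; [rewrite (Hlook0 f m (a n)); auto|].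
      destruct (le_lt_dec m (b n)) as [|Lb].
      { rewrite (Hlook0 f m (b n)); auto. now destruct look. }
      destruct (le_lt_dec m (c n)) as [|Lc].
      { rewrite (Hlook0 f m (c n)); auto. destruct (look (a n)), (look (b n)); auto. }
      destruct (Hlook f m _ La) as [ka [Ea ->]]. destruct (Hlook f m _ Lb) as [kb [Eb ->]].
      destruct (Hlook f m _ Lc) as [kc [Ec ->]]. rewrite Ea, Eb, Ec. simpl. apply H.
    + intros [y H] n. set (m := pair n (S (a n + b n + c n))).
      pose proof (le_pair n (S (a n + b n + c n))) as Hm. fold m in Hm.
      specialize (H m). rewrite unpair1_pair, len_code, restr_length in H.
      unfold m in H at 1; rewrite unpair1_pair in H. unfold G' in H.
      destruct (Hlook f m (a n)) as [ka [Ea Ea']]; [lia|].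
      destruct (Hlook f m (b n)) as [kb [Eb Eb']]; [lia|].
      destruct (Hlook f m (c n)) as [kc [Ec Ec']]; [lia|].
      rewrite Ea', Eb', Ec', Ea, Eb, Ec in H. exact H.
Qed.

(** The index carries a tag: 0 selects a condition of [A], any other tag one of [B]. *)
Lemma query_class_and A B : query_class A -> query_class B -> query_class (fun f => A f /\ B f).
Proof.
  intros [G [a [b [c [HG [Ha [Hb [Hc HA]]]]]]]] [G' [a' [b' [c' [HG' [Ha' [Hb' [Hc' HB]]]]]]]].
  unfold recursive in *.
  assert (Hif : forall g g' : nat -> nat, recursive g -> recursive g' ->
    recursive (fun n => ifz (unpair1 n) (g (unpair2 n)) (g' (unpair2 n)))).
  { intros g g' H H'. apply rec_ifz; [apply r_fst| |];
      [apply (r_comp _ g)|apply (r_comp _ g')]; auto with recdb. }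
  exists (fun p => ifz (unpair1 (unpair1 p)) (G (pair (unpair2 (unpair1 p)) (unpair2 p)))
    (G' (pair (unpair2 (unpair1 p)) (unpair2 p)))).
  exists (fun n => ifz (unpair1 n) (a (unpair2 n)) (a' (unpair2 n))).
  exists (fun n => ifz (unpair1 n) (b (unpair2 n)) (b' (unpair2 n))).
  exists (fun n => ifz (unpair1 n) (c (unpair2 n)) (c' (unpair2 n))).
  split; [|split; [|split; [|split]]]; try (apply Hif; auto; fail).
  - apply rec_ifz; [auto with recdb| |];
      [apply (r_comp _ G)|apply (r_comp _ G')]; auto 6 with recdb.
  - intros f. rewrite HA, HB. split.
    + intros [H H'] n. rewrite unpair1_pair, unpair2_pair.
      destruct (unpair1 n); simpl; auto.
    + intros H; split; intros n; [specialize (H (pair 0 n))|specialize (H (pair 1 n))];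
        rewrite !unpair1_pair, !unpair2_pair in H; exact H.
Qed.

(** * The Kleene basis theorem *)

Fixpoint append_fun (l : list nat) (z : nat -> nat) (i : nat) : nat :=
  match l, i with
  | [], _ => z i
  | a :: _, O => a
  | _ :: l', S i' => append_fun l' z i'
  end.

Lemma restr_ext (x y : nat -> nat) m : (forall i, i < m -> x i = y i) -> restr x m = restr y m.
Proof. intros H; apply map_ext_in; intros i Hi; apply in_seq in Hi; apply H; lia. Qed.

Lemma restr_append_fun l z m :
  restr (append_fun l z) (length l + m) = l ++ restr z m.
Proof.
  induction l as [|a l IH]; simpl; [reflexivity|]. rewrite <- IH.
  unfold restr; simpl. now rewrite <- seq_shift, map_map.
Qed.

Lemma append_fun_snoc l z i :
  append_fun (l ++ [z 0]) (fun j => z (S j)) i = append_fun l z i.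
Proof.
  revert i; induction l as [|a l IH]; intros [|i]; simpl; auto.
Qed.

Lemma restr_map f (x : nat -> nat) m : map f (restr x m) = restr (fun i => f (x i)) m.
Proof. unfold restr; now rewrite map_map. Qed.

(* The set of strings that do not extend to a pair (member, witness) is [Pi11], so [o] decides it
   and computes a path by always taking the least extendible one-step extension. *)
Lemma Kleene_basis (O : nat -> Prop) (o : nat -> nat) :
  Pi11_complete O -> char_fun O o -> Sigma11_basis (fun x => rec_in o x).
Proof.
  intros [_ Hcomp] Ho A [R [HR HA]] [x0 Hx0].
  (* A member and its witness are merged into one sequence of pairs. [Ext] takes strings in reverse,
     so that a one-step extension is a cons also on codes. *)
  set (P := fun l => R (pair (code (map unpair1 l)) (code (map unpair2 l))) = 0).
  set (Ext := fun l => exists z, forall m, P (rev l ++ restr z m)).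
  assert (HAP : forall z, (forall n, P (restr z n)) -> A (fun i => unpair1 (z i))).
  { intros z Hz. apply HA. exists (fun i => unpair2 (z i)). intros n.
    rewrite <- (restr_map unpair1), <- (restr_map unpair2). apply Hz. }
  assert (Hroot : Ext []).
  { apply HA in Hx0 as [y0 Hy0]. exists (fun i => pair (x0 i) (y0 i)). intros m.
    unfold P; simpl. rewrite !restr_map.
    rewrite (restr_ext (fun i => unpair1 _) x0), (restr_ext (fun i => unpair2 _) y0);
      auto using unpair1_pair, unpair2_pair. }
  assert (Hstep : forall l, Ext l -> exists a, Ext (a :: l)).
  { intros l [z Hz]. exists (z 0), (fun j => z (S j)). intros m. simpl.
    rewrite <- restr_append_fun. rewrite (restr_ext _ (append_fun (rev l) z)).
    - rewrite length_app, <- Nat.add_assoc, restr_append_fun. apply Hz.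
    - intros; apply append_fun_snoc. }
  destruct (Hcomp (fun c => ~ Ext (decode c))) as [g [Hg HY]].
  (* [1 - R] exchanges zero and nonzero: a string is not extendible if every continuation violates
     [P] at some stage. *)
  { exists (fun p => 1 - R (pair (map_code unpair1 (rev_map_code (fun n => n) (unpair1 p) (unpair2 p)))
                                 (map_code unpair2 (rev_map_code (fun n => n) (unpair1 p) (unpair2 p))))).
    split.
    - apply rec_sub; [apply rec_const|]. apply (r_comp _ R); auto.
      apply r_pair; apply rec_map; auto with recdb; apply rec_rev_map; auto with recdb.
    - intros c. destruct (code_surj c) as [l <-]. rewrite decode_code.
      assert (Heq : forall y m, R (pair (map_code unpair1 (rev_map_code (fun n => n)
                (unpair1 (pair (code l) (code (restr y m)))) (unpair2 (pair (code l) (code (restr y m))))))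
              (map_code unpair2 (rev_map_code (fun n => n)
                (unpair1 (pair (code l) (code (restr y m)))) (unpair2 (pair (code l) (code (restr y m)))))))
            = 0 <-> P (rev l ++ restr y m)).
      { intros y m. rewrite unpair1_pair, unpair2_pair, rev_map_code_code, !map_code_code, map_id.
        reflexivity. }
      split.
      + intros H y. apply NNPP; intros Hn. apply H; exists y; intros m. apply Heq.
        apply NNPP; intros Hne. apply Hn; exists m. lia.
      + intros H [z Hz]. destruct (H z) as [m Hm]. specialize (Hz m). apply Heq in Hz. lia. }
  assert (HE : forall l, Ext l <-> o (g (code l)) = 0).
  { intros l. specialize (HY (code l)). rewrite decode_code in HY.
    destruct (Ho (g (code l))) as [H1 H0]. split.
    - intros H; apply H0; tauto.
    - intros H. apply NNPP; intros Hn. apply HY in Hn. apply H1 in Hn. congruence. }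
  pose proof (recursive_rec_in o g Hg) as Hgo.
  (* [o (g c) = 0] means extendible. On other strings [test] is 0 by default, which makes the
     minimisation total. *)
  set (test := fun p => ifz (o (g (unpair1 p))) (o (g (S (pair (unpair2 p) (unpair1 p))))) 0).
  assert (Htest : rec_in o test).
  { apply rec_ifz; auto with recdb; apply (r_comp _ o); try apply r_oracle;
      apply (r_comp _ g); auto 6 with recdb. }
  assert (Hmin : forall c, exists a, test (pair c a) = 0 /\ forall b, b < a -> test (pair c b) <> 0).
  { intros c. assert (exists a, test (pair c a) = 0) as [a Ha].
    { unfold test. destruct (code_surj c) as [l <-].
      destruct (o (g (code l))) eqn:E.
      - apply HE in E as HEl. apply Hstep in HEl as [a Ha]. exists a.
        rewrite unpair1_pair, unpair2_pair, E. now apply HE in Ha.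
      - exists 0. now rewrite unpair1_pair, E. }
    revert Ha. induction a as [a IH] using lt_wf_ind; intros Ha.
    destruct (classic (exists b, b < a /\ test (pair c b) = 0)) as [[b [Hb Hb']]|Hn].
    - apply (IH b); auto.
    - exists a; split; auto. intros b Hb Hb'; apply Hn; eauto. }
  set (next := fun c => proj1_sig (constructive_indefinite_description _ (Hmin c))).
  assert (Hnext : forall c, test (pair c (next c)) = 0 /\ forall b, b < next c -> test (pair c b) <> 0).
  { intros c; exact (proj2_sig (constructive_indefinite_description _ (Hmin c))). }
  assert (Hrnext : rec_in o next) by (apply r_min with test; auto).
  set (step := fun c => S (pair (next c) c)).
  set (z := fun n => next (Nat.iter n step 0)).
  assert (Hz : forall n, Nat.iter n step 0 = code (rev (restr z n)) /\ Ext (rev (restr z n))).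
  { induction n as [|n [IH1 IH2]]; [split; auto|].
    assert (E : rev (restr z (S n)) = z n :: rev (restr z n)).
    { rewrite restr_S. apply rev_app_distr. }
    rewrite E. split.
    - simpl Nat.iter. unfold step at 1. change (next (Nat.iter n step 0)) with (z n).
      rewrite IH1. reflexivity.
    - destruct (Hnext (Nat.iter n step 0)) as [Ht _]. change (next (Nat.iter n step 0)) with (z n) in Ht.
      rewrite IH1 in Ht. unfold test in Ht. rewrite unpair1_pair, unpair2_pair in Ht.
      apply HE in IH2. rewrite IH2 in Ht. simpl ifz in Ht. now apply HE. }
  exists (fun i => unpair1 (z i)). split.
  - apply HAP. intros n. destruct (Hz n) as [_ [y Hy]]. specialize (Hy 0).
    now rewrite rev_involutive, app_nil_r in Hy.
  - apply rec_unpair1. unfold z. apply (r_comp _ next); auto.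
    apply rec_iter; auto with recdb. unfold step. auto with recdb.
Qed.
Close Scope nat_scope.

(** * Dyadic weights and Hausdorff measure *)

(** The ceiling of [n * s] for [s = p / q]. *)
Definition hexp (p q n : nat) : nat := ((n * p + (q - 1)) / q)%nat.

(* The power of two [wt p q n] lies within a factor 2 of [2^(- n s)] for [s = p / q]. *)
Definition wt (p q n : nat) : R := / 2 ^ hexp p q n.

Lemma hexp_spec p q n : (0 < q)%nat ->
  (n * p <= hexp p q n * q < n * p + q)%nat.
Proof.
  intros Hq. unfold hexp.
  pose proof (Nat.div_mod_eq (n * p + (q - 1)) q).
  pose proof (Nat.mod_upper_bound (n * p + (q - 1)) q). nia.
Qed.

Lemma hexp_mono p q n : (0 < q)%nat -> (hexp p q n <= hexp p q (S n))%nat.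
Proof.
  intros Hq. pose proof (hexp_spec p q n Hq). pose proof (hexp_spec p q (S n) Hq).
  nia.
Qed.

Lemma hexp_ge p q n : (0 < p)%nat -> (0 < q)%nat -> (n <= hexp p q (n * q))%nat.
Proof.
  intros Hp Hq. destruct (hexp_spec p q (n * q) Hq) as [H _].
  apply Nat.mul_le_mono_pos_r with q; auto. nia.
Qed.

Lemma rec_hexp o p q a : (0 < q)%nat -> rec_in o a -> rec_in o (fun n => hexp p q (a n)).
Proof.
  intros Hq. apply (r_comp o (hexp p q)).
  apply r_min with (fun z => unpair1 z * p - unpair2 z * q)%nat; [auto with recdb|].
  intros n. rewrite unpair1_pair, unpair2_pair. pose proof (hexp_spec p q n Hq). split; [lia|].
  intros y Hy. rewrite unpair1_pair, unpair2_pair. nia.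
Qed.

Lemma inv_pow2_le n m : (n <= m)%nat -> / 2 ^ m <= / 2 ^ n.
Proof. intros H. apply Rinv_le_contravar; [apply pow_lt; lra|apply Rle_pow; auto; lra]. Qed.

Lemma inv_pow2_pos n : 0 < / 2 ^ n.
Proof. apply Rinv_0_lt_compat, pow_lt; lra. Qed.

Lemma inv_pow2_small e : 0 < e -> exists n, / 2 ^ n < e.
Proof.
  intros He. destruct (pow_lt_1_zero (/ 2)) with (y := e) as [n Hn]; auto.
  { rewrite Rabs_pos_eq; lra. }
  exists n. specialize (Hn n (Nat.le_refl _)). rewrite Rabs_pos_eq in Hn by (apply pow_le; lra).
  now rewrite <- pow_inv.
Qed.

Lemma weight_wt p q : (0 < q)%nat -> weight (wt p q).
Proof.
  intros Hq; split; intros n; [apply inv_pow2_pos|apply inv_pow2_le, hexp_mono; auto].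
Qed.

Lemma wt_small p q e : (0 < p)%nat -> (0 < q)%nat -> 0 < e -> exists n, wt p q n <= e.
Proof.
  intros Hp Hq He. destruct (inv_pow2_small e He) as [n Hn]. exists (n * q)%nat.
  apply Rle_trans with (/ 2 ^ n); [|lra]. now apply inv_pow2_le, hexp_ge.
Qed.

Lemma inv_pow2_exp k : / 2 ^ k = exp (- (INR k * ln 2)).
Proof.
  rewrite exp_Ropp. f_equal. rewrite <- Rpower_pow by lra. reflexivity.
Qed.

Lemma Rpower_inv_pow2 n s : Rpower (/ 2 ^ n) s = exp (- (s * INR n * ln 2)).
Proof.
  unfold Rpower. rewrite inv_pow2_exp, ln_exp. f_equal; ring.
Qed.

Lemma ln2_pos : 0 < ln 2.
Proof. rewrite <- ln_1; apply ln_increasing; lra. Qed.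

Lemma exp_le x y : x <= y -> exp x <= exp y.
Proof. intros [H| ->]; [left; now apply exp_increasing|lra]. Qed.

Lemma wt_bounds p q n : (0 < q)%nat ->
  wt p q n <= Rpower (/ 2 ^ n) (INR p / INR q) <= 2 * wt p q n.
Proof.
  intros Hq. rewrite Rpower_inv_pow2. unfold wt. rewrite inv_pow2_exp.
  pose proof ln2_pos. assert (0 < INR q) by now apply lt_0_INR.
  destruct (hexp_spec p q n Hq) as [H1 H2].
  apply le_INR in H1. apply lt_INR in H2. rewrite plus_INR in H2. rewrite !mult_INR in H1, H2.
  assert (E : INR p / INR q * INR n * INR q = INR n * INR p) by (field; lra).
  split.
  - apply exp_le. apply Ropp_le_contravar, Rmult_le_compat_r; [lra|].
    apply Rmult_le_reg_r with (INR q); lra.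
  - rewrite <- (exp_ln 2) at 2 by lra. rewrite <- exp_plus. apply exp_le.
    assert (INR (hexp p q n) <= INR p / INR q * INR n + 1); [|nra].
    apply Rmult_le_reg_r with (INR q); lra.
Qed.

Lemma first_difference (x y : nat -> bool) n :
  ~ (forall i, (i < n)%nat -> x i = y i) ->
  exists k, (k < n)%nat /\ x k <> y k /\ forall i, (i < k)%nat -> x i = y i.
Proof.
  induction n as [|n IH]; intros H; [exfalso; apply H; lia|].
  destruct (classic (forall i, (i < n)%nat -> x i = y i)) as [Hn|Hn].
  - exists n; repeat split; auto. intros E; apply H. intros i Hi.
    destruct (Nat.eq_dec i n); subst; auto. apply Hn; lia.
  - destruct (IH Hn) as [k [? ?]]; exists k; split; auto; lia.
Qed.

(** The continuations of [s] by constant [true] and constant [false] first differ at [length s], and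
    so realise the diameter of the cylinder. *)
Fixpoint fill (s : list bool) (b : bool) (i : nat) : bool :=
  match s with
  | [] => b
  | a :: s' => if (i =? length s')%nat then a else fill s' b i
  end.

Lemma cyl_fill s b : cyl s (fill s b).
Proof.
  unfold cyl; induction s as [|a s IH]; auto. cbn [length pre].
  rewrite (pre_ext _ (fill s b)).
  - rewrite IH. simpl. now rewrite Nat.eqb_refl.
  - intros i Hi; simpl. destruct (Nat.eqb_spec i (length s)); auto; lia.
Qed.

Lemma fill_length s b : fill s b (length s) = b.
Proof.
  enough (forall i, (length s <= i)%nat -> fill s b i = b) by auto.
  induction s as [|a s IH]; simpl; auto. intros i Hi.
  destruct (Nat.eqb_spec i (length s)); [lia|]. apply IH; lia.
Qed.

Lemma diam_cyl s : diam_is (cyl s) (/ 2 ^ length s).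
Proof.
  split; [left; apply inv_pow2_pos|split].
  - intros x y r Hx Hy [[_ ->]|[k [Hk [_ ->]]]]; [left; apply inv_pow2_pos|].
    apply inv_pow2_le. destruct (le_lt_dec (length s) k); auto. exfalso; apply Hk.
    apply (pre_inj x y (length s)); auto. unfold cyl in *; congruence.
  - intros d _ H. apply (H (fill s true) (fill s false)); try apply cyl_fill.
    right; exists (length s). rewrite !fill_length. repeat split; [discriminate|].
    apply pre_inj. pose proof (cyl_fill s true); pose proof (cyl_fill s false).
    unfold cyl in *; congruence.
Qed.

Lemma rsum_seq F n : rsum F (seq 0 (S n)) = sum_f_R0 F n.
Proof.
  induction n as [|n IH]; [simpl; lra|].
  rewrite seq_S, rsum_app, IH. simpl; lra.
Qed.

Lemma pow_s_nonneg s d : 0 <= pow_s s d.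
Proof.
  unfold pow_s; destruct Rle_dec; [lra|]. left; apply exp_pos.
Qed.

Lemma infinite_sum_bounded a b :
  (forall n, 0 <= a n) -> (forall n, sum_f_R0 a n <= b) ->
  exists v, infinite_sum a v /\ v <= b.
Proof.
  intros Ha Hb.
  destruct (growing_cv (sum_f_R0 a)) as [v Hv].
  - intros n; simpl; specialize (Ha (S n)); lra.
  - exists b. intros r [n ->]; auto.
  - exists v; split; [exact Hv|].
    apply Rnot_lt_le; intros Hlt. destruct (Hv (v - b)) as [N HN]; [lra|].
    specialize (HN N (Nat.le_refl _)). specialize (Hb N). unfold Rdist in HN.
    apply Rabs_def2 in HN; lra.
Qed.

(** Content zero gives measure zero: a cover cheaper than [wt p q N] uses only strings longer than
    [N], hence is a [delta]-cover as soon as [/ 2 ^ N < delta], and its [s]-sum is at most twice its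
    cost. *)
Lemma Hs_pos_content p q E : (0 < p)%nat -> (0 < q)%nat ->
  Hs_pos (INR p / INR q) E -> exists t, 0 < t /\ ~ cov (wt p q) E t.
Proof.
  intros Hp Hq [delta [Hd [eps [He Hv]]]]. apply NNPP; intros Hn.
  assert (Hcov : forall t, 0 < t -> cov (wt p q) E t).
  { intros t Ht; apply NNPP; intros Hc; apply Hn; eauto. }
  pose proof (weight_wt p q Hq) as Hw.
  destruct (inv_pow2_small delta Hd) as [N HN].
  pose proof (proj1 Hw N) as HwN.
  set (t := Rmin (eps / 4) (wt p q N / 2)).
  assert (Ht : 0 < t) by (apply Rmin_glb_lt; lra).
  assert (Ht1 : t <= eps / 4) by apply Rmin_l.
  assert (Ht2 : t <= wt p q N / 2) by apply Rmin_r.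
  destruct (Hcov t Ht) as [W [HW Hc]].
  set (e := fun i => map (fun k => negb (k =? 0)%nat) (decode i)).
  set (idx := fun s => code (map b2n s)).
  assert (Hei : forall s, e (idx s) = s).
  { intros s; unfold e, idx. rewrite decode_code, map_map.
    rewrite <- (map_id s) at 2. apply map_ext. now intros []. }
  (* Many numbers decode to the same string; only the canonical code of a member of [W] counts. All
     other indices get the empty set, of diameter 0. *)
  set (ok := fun i => W (e i) /\ i = idx (e i)).
  set (d := fun i => if classicb (ok i) then / 2 ^ length (e i) else 0).
  set (U := fun i x => ok i /\ cyl (e i) x).
  assert (Hlen : forall i, ok i -> (N < length (e i))%nat).
  { intros i [Hi _]. destruct (le_lt_dec (length (e i)) N) as [Hle|]; auto. exfalso.
    pose proof (weight_mono _ Hw _ _ Hle).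
    specialize (Hc [e i]); simpl in Hc.
    assert (wt p q (length (e i)) + 0 <= t); [|lra]. apply Hc.
    - repeat constructor; intros [].
    - intros ? [<-|[]]; auto. }
  assert (Hsum : forall n, sum_f_R0 (fun i => pow_s (INR p / INR q) (d i)) n <= 2 * t).
  { intros n. rewrite <- rsum_seq.
    apply Rle_trans with (2 * rsum (fun s => wt p q (length s))
      (map e (filter (fun i => classicb (ok i)) (seq 0 (S n))))).
    - rewrite <- rsum_scal. generalize (seq 0 (S n)) as l.
      induction l as [|i l IH]; simpl; [lra|]. unfold d at 1, pow_s at 1.
      destruct (classicb (ok i)); simpl.
      + pose proof (inv_pow2_pos (length (e i))). destruct Rle_dec; [lra|].
        pose proof (wt_bounds p q (length (e i)) Hq); lra.
      + destruct Rle_dec; lra.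
    - apply Rmult_le_compat_l; [lra|]. apply Hc.
      + apply NoDup_map_NoDup_ForallPairs; [|apply NoDup_filter, seq_NoDup].
        intros i j Hi Hj E'. apply filter_In in Hi as [_ Hi]. apply filter_In in Hj as [_ Hj].
        apply classicb_true in Hi as [_ ->]. apply classicb_true in Hj as [_ ->]. now rewrite E'.
      + intros s Hs. apply in_map_iff in Hs as [i [<- Hi]]. apply filter_In in Hi as [_ Hi].
        apply classicb_true in Hi as [? _]; auto. }
  destruct (infinite_sum_bounded _ _ (fun i => pow_s_nonneg _ (d i)) Hsum) as [v [Hsv Hvt]].
  assert (eps <= v); [|lra]. apply Hv. exists U, d; repeat split; auto.
  - unfold d. destruct classicb; [left; apply inv_pow2_pos|lra].
  - intros x y r [Ho Hx] [_ Hy] Hr. unfold d. rewrite (classicb_intro _ Ho).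
    exact (proj1 (proj2 (diam_cyl (e i))) x y r Hx Hy Hr).
  - intros d' Hd' H. unfold d. destruct (classicb (ok i)) eqn:Eok; auto.
    apply classicb_true in Eok. apply (proj2 (proj2 (diam_cyl (e i)))); auto.
    intros x y r Hx Hy. apply H; split; auto.
  - intros i. unfold d. destruct (classicb (ok i)) eqn:Eok; [|lra].
    apply classicb_true in Eok. apply Rle_trans with (/ 2 ^ N); [|lra].
    apply inv_pow2_le. apply Nat.lt_le_incl; auto.
  - intros x Hx. destruct (HW x Hx) as [s [Hs Hsx]]. exists (idx s). unfold U, ok.
    rewrite Hei. auto.
Qed.

Lemma exists_dyadic_scale d : 0 < d <= 1 -> exists n, / 2 ^ S n < d <= / 2 ^ n.
Proof.
  intros [H0 H1]. destruct (inv_pow2_small d H0) as [n Hn].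
  induction n as [|n IH]; [simpl in Hn; lra|].
  destruct (Rlt_le_dec (/ 2 ^ n) d); eauto.
Qed.

(** A set of diameter [d > 0] lies in a cylinder of some length [n] with [/ 2 ^ n < 2 * d], and
    [(2 d)^s <= 2 d^s] because [s < 1]. A set of diameter 0 contributes nothing to the sum, so it
    gets a cylinder long enough to cost at most [eta]. *)
Lemma diam_cyl_cover p q U d eta : (0 < p)%nat -> (p < q)%nat ->
  diam_is U d -> d <= 1 -> 0 < eta ->
  exists s, (forall x, U x -> cyl s x) /\ wt p q (length s) <= 2 * pow_s (INR p / INR q) d + eta.
Proof.
  intros Hp Hpq [Hd0 [Hub _]] Hd1 Heta. assert (Hq : (0 < q)%nat) by lia.
  destruct (wt_small p q eta Hp Hq Heta) as [m Hm].
  pose proof (pow_s_nonneg (INR p / INR q) d) as Hpow.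
  destruct (classic (exists x, U x)) as [[x Hx]|HU].
  2: { exists (pre (fun _ => true) m); split; [|rewrite pre_length; lra].
       intros x Hx; exfalso; eauto. }
  assert (Hagree : forall n, (forall k, (k < n)%nat -> d < / 2 ^ k) ->
    forall y, U y -> cyl (pre x n) y).
  { intros n Hn y Hy. unfold cyl. rewrite pre_length. apply pre_ext.
    apply NNPP; intros Hne. apply first_difference in Hne as [k [Hk [Hyk Hik]]].
    specialize (Hub y x (/ 2 ^ k) Hy Hx). specialize (Hn k Hk).
    assert (/ 2 ^ k <= d); [|lra]. apply Hub. right; eauto. }
  destruct Hd0 as [Hd0|<-].
  - destruct (exists_dyadic_scale d) as [n [Hn1 Hn2]]; [lra|].
    exists (pre x n); split.
    + apply Hagree. intros k Hk. pose proof (inv_pow2_le (S k) n Hk) as Hle.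
      simpl in Hle. rewrite Rinv_mult in Hle. lra.
    + rewrite pre_length. assert (Hpq' : 0 < INR p / INR q < 1).
      { apply lt_INR in Hpq. apply lt_0_INR in Hp, Hq.
        split; [now apply Rdiv_lt_0_compat|]. apply Rmult_lt_reg_r with (INR q); auto.
        unfold Rdiv; rewrite Rmult_assoc, Rinv_l; lra. }
      apply Rle_trans with (2 * pow_s (INR p / INR q) d); [|lra].
      unfold pow_s; destruct Rle_dec; [lra|].
      eapply Rle_trans; [apply wt_bounds; auto|].
      apply Rle_trans with (Rpower (2 * d) (INR p / INR q)).
      * apply Rle_Rpower_l; [lra|]. split; [apply inv_pow2_pos|].
        simpl in Hn1. rewrite Rinv_mult in Hn1. lra.
      * rewrite <- Rpower_mult_distr by lra. apply Rmult_le_compat_r; [left; apply exp_pos|].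
        rewrite <- (Rpower_1 2) at 2 by lra. apply Rle_Rpower; lra.
  - exists (pre x m); split; [|rewrite pre_length; lra].
    apply Hagree. intros k _; apply inv_pow2_pos.
Qed.

(** Positivity in the form that Koenig's lemma can deliver: a point of [C] that escapes a given
    cheap sequence of cylinders. *)
Lemma content_Hs_pos p q C c : (0 < p)%nat -> (p < q)%nat -> 0 < c ->
  (forall s : nat -> list bool,
    (forall n, rsum (fun i => wt p q (length (s i))) (seq 0 n) < c) ->
    exists x, C x /\ forall i, ~ cyl (s i) x) ->
  Hs_pos (INR p / INR q) C.
Proof.
  (* A cover with sum [v < c / 8] yields cylinders of cost at most [2 * v + c / 4], which is below
     [c]; the [c / 4] pays for the errors [eta]. *)
  intros Hp Hpq Hc H. exists 1; split; [lra|]. exists (c / 8); split; [lra|].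
  intros v [U [d [Hdiam [Hd [Hcover Hsum]]]]].
  apply Rnot_lt_le; intros Hlt.
  assert (Hs : forall i, exists s, (forall x, U i x -> cyl s x) /\
    wt p q (length s) <= 2 * pow_s (INR p / INR q) (d i) + c / 4 * (/ 2) ^ S i).
  { intros i. apply diam_cyl_cover; auto.
    apply Rmult_lt_0_compat; [lra|apply pow_lt; lra]. }
  set (s := fun i => proj1_sig (constructive_indefinite_description _ (Hs i))).
  assert (Hs' : forall i, (forall x, U i x -> cyl (s i) x) /\
    wt p q (length (s i)) <= 2 * pow_s (INR p / INR q) (d i) + c / 4 * (/ 2) ^ S i).
  { intros i; exact (proj2_sig (constructive_indefinite_description _ (Hs i))). }
  destruct (H s) as [x [Hx Hn]].
  - intros n. apply Rle_lt_trans with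
      (2 * rsum (fun i => pow_s (INR p / INR q) (d i)) (seq 0 n)
        + rsum (fun i => c / 4 * (/ 2) ^ S i) (seq 0 n)).
    + generalize (seq 0 n) as l; induction l as [|i l IH]; [simpl; lra|].
      cbn [rsum]. pose proof (proj2 (Hs' i)). lra.
    + pose proof (rsum_nat_geom (c / 4) (seq 0 n) ltac:(lra) (seq_NoDup _ _)).
      assert (rsum (fun i => pow_s (INR p / INR q) (d i)) (seq 0 n) <= v); [|lra].
      pose proof (fun N => sum_incr _ N v Hsum (fun i => pow_s_nonneg _ (d i))) as Hinc.
      destruct n as [|n]; [|rewrite rsum_seq; auto].
      specialize (Hinc 0%nat); simpl in *. pose proof (pow_s_nonneg (INR p / INR q) (d 0%nat)); lra.
  - destruct (Hcover x Hx) as [i Hi]. apply (Hn i), Hs'; auto.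
Qed.

(** * Compactness *)

Lemma dependent_choice {X : Type} (Q : list X -> Prop) :
  Q [] -> (forall l, Q l -> exists a, Q (a :: l)) -> exists y : nat -> X, forall n, Q (pre y n).
Proof.
  intros H0 HS. destruct (HS [] H0) as [a0 _].
  assert (Hnx : forall l, exists a, Q l -> Q (a :: l)).
  { intros l. destruct (classic (Q l)) as [Hl|Hl]; [|exists a0; tauto].
    destruct (HS l Hl) as [a Ha]; eauto. }
  set (nx := fun l => proj1_sig (constructive_indefinite_description _ (Hnx l))).
  assert (Hn : forall l, Q l -> Q (nx l :: l)).
  { intros l; exact (proj2_sig (constructive_indefinite_description _ (Hnx l))). }
  set (st := fix st n := match n with O => [] | S m => nx (st m) :: st m end).
  exists (fun n => nx (st n)). intros n.
  assert (pre (fun n => nx (st n)) n = st n) as ->.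
  { induction n as [|n IH]; simpl; congruence. }
  induction n; simpl; auto.
Qed.

(** Keep to the strings with extensions of every height. If no child of such a string were of this
    kind, its finitely many admissible children would have a common bound on their heights. *)
Lemma koenig {X : Type} (P : list X -> Prop) (choices : nat -> list X) :
  (forall a l, P (a :: l) -> P l /\ In a (choices (length l))) ->
  (forall n, exists l, length l = n /\ P l) ->
  exists y : nat -> X, forall n, P (pre y n).
Proof.
  intros HP Hn.
  assert (Hsuf : forall m l, P (m ++ l) -> P l).
  { induction m as [|a m IH]; simpl; auto. intros l H; apply IH, (HP a), H. }
  set (Inf := fun l => forall n, exists m, length m = n /\ P (m ++ l)).
  destruct (dependent_choice Inf) as [y Hy].
  - intros n. destruct (Hn n) as [l [Hl Hp]]. exists l. now rewrite app_nil_r.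
  - intros l Hl. apply NNPP; intros Hno.
    assert (Hb : forall L : list X, exists N, forall a, In a L -> forall m, (N <= length m)%nat ->
      ~ P (m ++ a :: l)).
    { induction L as [|a L [N HN]]; [exists O; intros ? []|].
      assert (~ Inf (a :: l)) as Ha by eauto. apply not_all_ex_not in Ha as [k Hk].
      exists (N + k)%nat. intros b [<-|Hb] m Hm HPm.
      - apply Hk. exists (skipn (length m - k) m). rewrite length_skipn. split; [lia|].
        apply Hsuf with (firstn (length m - k) m). now rewrite app_assoc, firstn_skipn.
      - apply (HN b Hb m); auto; lia. }
    destruct (Hb (choices (length l))) as [N HN].
    destruct (Hl (S N)) as [m [Hm HPm]].
    destruct m as [|a m _] using rev_ind; [discriminate|].
    rewrite length_app in Hm; simpl in Hm. rewrite <- app_assoc in HPm; simpl in HPm.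
    apply (HN a) with (m := m); auto; [|lia]. apply HP. now apply Hsuf in HPm.
  - exists y. intros n. destruct (Hy n 0%nat) as [[|? ?] [Hm HPm]]; [auto|discriminate].
Qed.

Lemma rev_pre (x : nat -> nat) n : rev (pre x n) = restr x n.
Proof.
  induction n as [|n IH]; auto. rewrite restr_S, <- IH. reflexivity.
Qed.

Lemma skipn_pre {X : Type} (x : nat -> X) n i : skipn i (pre x n) = pre x (n - i).
Proof.
  revert i; induction n as [|n IH]; intros [|i]; simpl; auto.
Qed.

Lemma map_pre {X Y : Type} (h : X -> Y) (x : nat -> X) n : map h (pre x n) = pre (fun i => h (x i)) n.
Proof. induction n; simpl; congruence. Qed.

(** * Certificates *)

(* [v] is either [0] or the successor of the code of a witness string for the string coded by [c];
   both strings are inspected with their last [i] entries removed, [w] bounding the then last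
   entry of the witness. *)
Definition tree_check (R : nat -> nat) (v w c i : nat) : nat :=
  ifz v 0
    (R (pair (rev_code (Nat.iter i tl_code c)) (rev_code (Nat.iter i tl_code (pred v)))) +
     ifz (Nat.iter i tl_code c) (Nat.iter i tl_code (pred v))
       (ifz (Nat.iter i tl_code (pred v)) 1 (hd_code (Nat.iter i tl_code (pred v)) - w))).

(* With [f <0, l>] as bounds and [f <1, l>] as witnesses (nonzero on a tree of strings), the first
   two clauses make every path of the tree a member of the projection of [R]. The value
   [f <2, <j, l>>], divided by [2 ^ hexp (length l + j)], is a lower bound for the content of
   the part of the tree above [l], as far as it is seen [j] levels further up. *)
Definition certificate (R : nat -> nat) (p q M : nat) (f : nat -> nat) : Prop :=
  (forall l i, tree_check R (f (pair 1 (code l))) (f (pair 0 (code (skipn i l)))) (code l) i = 0%nat) /\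
  (forall l, f (pair 1 (code l)) <> 0%nat -> f (pair 1 (code (tl l))) <> 0%nat) /\
  (forall j l, (f (pair 2 (pair (S j) (code l))) <=
     f (pair 2 (pair j (code (0%nat :: l)))) + f (pair 2 (pair j (code (1%nat :: l)))))%nat) /\
  (forall l, f (pair 2 (pair 0 (code l))) <> 0%nat -> f (pair 1 (code l)) <> 0%nat) /\
  (forall j l, (f (pair 2 (pair j (code l))) * 2 ^ hexp p q (length l)
     <= 2 ^ hexp p q (length l + j))%nat) /\
  (forall j, (2 ^ hexp p q j <= 2 ^ M * f (pair 2 (pair j 0)))%nat).

Lemma query_class_intro (A : (nat -> nat) -> Prop) (G : nat -> nat -> nat -> nat -> nat) a b c :
  recursive (fun z => G (unpair1 z) (unpair1 (unpair2 z)) (unpair1 (unpair2 (unpair2 z)))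
    (unpair2 (unpair2 (unpair2 z)))) ->
  recursive a -> recursive b -> recursive c ->
  (forall f, A f <-> forall n, G n (f (a n)) (f (b n)) (f (c n)) = 0%nat) ->
  query_class A.
Proof.
  intros HG Ha Hb Hc HA. eexists _, a, b, c. split; [exact HG|]. repeat split; auto.
  - intros H n. rewrite !unpair2_pair, !unpair1_pair. now apply HA.
  - intros H; apply HA. intros n. specialize (H n).
    now rewrite !unpair2_pair, !unpair1_pair in H.
Qed.

(** Inequalities become truncated differences, and implications between nonzero values become
    [ifz v 0 (1 - w)]. Quantifiers over lists turn into quantifiers over numbers because every
    number codes a list. *)
Lemma query_class_certificate R p q M :
  recursive R -> (0 < q)%nat -> query_class (certificate R p q M).
Proof.
  intros HR Hq. unfold certificate.
  apply query_class_and; [|apply query_class_and; [|apply query_class_and;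
    [|apply query_class_and; [|apply query_class_and]]]].
  - apply query_class_intro with
      (G := fun n v w _ => tree_check R v w (unpair1 n) (unpair2 n))
      (a := fun n => pair 1 (unpair1 n))
      (b := fun n => pair 0 (Nat.iter (unpair2 n) tl_code (unpair1 n)))
      (c := fun n => n); unfold recursive in *; auto with recdb.
    + unfold tree_check.
      pose proof (rec_iter_tl (fun _ => 0%nat) (fun z => unpair2 (unpair1 z))
        (fun z => unpair1 (unpair1 z))) as H1.
      pose proof (rec_iter_tl (fun _ => 0%nat) (fun z => unpair2 (unpair1 z))
        (fun z => pred (unpair1 (unpair2 z)))) as H2.
      apply rec_ifz; [auto with recdb|auto with recdb|].
      apply rec_add; [|auto 10 with recdb].
      apply (r_comp _ R); auto 10 with recdb.
    + intros f; split.
      * intros H n. destruct (code_surj (unpair1 n)) as [l <-]. rewrite iter_tl_code. apply H.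
      * intros H l i. specialize (H (pair (code l) i)).
        rewrite unpair1_pair, unpair2_pair, iter_tl_code in H. exact H.
  - apply query_class_intro with
      (G := fun n v w _ => ifz v 0 (1 - w))
      (a := fun n => pair 1 n) (b := fun n => pair 1 (tl_code n))
      (c := fun n => n); unfold recursive; auto 8 with recdb.
    intros f; split.
    + intros H n. destruct (code_surj n) as [l <-]. rewrite tl_code_code. specialize (H l).
      destruct (f (pair 1 (code l))) eqn:E; cbn [ifz]; [reflexivity|]. specialize (H ltac:(lia)); lia.
    + intros H l Hl. specialize (H (code l)). rewrite tl_code_code in H.
      destruct (f (pair 1 (code l))); cbn [ifz] in H; [congruence|lia].
  - apply query_class_intro with
      (G := fun n u v w => (u - (v + w))%nat)
      (a := fun n => pair 2 (pair (S (unpair1 n)) (unpair2 n)))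
      (b := fun n => pair 2 (pair (unpair1 n) (S (pair 0 (unpair2 n)))))
      (c := fun n => pair 2 (pair (unpair1 n) (S (pair 1 (unpair2 n)))));
      unfold recursive; auto 10 with recdb.
    intros f; split.
    + intros H n. destruct (code_surj (unpair2 n)) as [l <-].
      specialize (H (unpair1 n) l). simpl code in H. lia.
    + intros H j l. specialize (H (pair j (code l))).
      rewrite unpair1_pair, unpair2_pair in H. simpl code; lia.
  - apply query_class_intro with
      (G := fun n v w _ => ifz v 0 (1 - w))
      (a := fun n => pair 2 (pair 0 n)) (b := fun n => pair 1 n)
      (c := fun n => n); unfold recursive; auto 8 with recdb.
    intros f; split.
    + intros H n. destruct (code_surj n) as [l <-]. specialize (H l).
      destruct (f (pair 2 (pair 0 (code l)))) eqn:E; cbn [ifz]; [reflexivity|].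
      specialize (H ltac:(lia)); lia.
    + intros H l Hl. specialize (H (code l)).
      destruct (f (pair 2 (pair 0 (code l)))); cbn [ifz] in H; [congruence|lia].
  - apply query_class_intro with
      (G := fun n v _ _ => (v * 2 ^ hexp p q (len (unpair2 n)) -
                            2 ^ hexp p q (len (unpair2 n) + unpair1 n))%nat)
      (a := fun n => pair 2 n) (b := fun n => n) (c := fun n => n);
      unfold recursive; auto with recdb.
    + apply rec_sub; [apply rec_mul; [auto with recdb|]|]; apply rec_pow, rec_hexp; auto 7 with recdb.
    + intros f; split.
      * intros H n. rewrite <- (pair_unpair n), unpair1_pair, unpair2_pair.
        destruct (code_surj (unpair2 n)) as [l <-]. rewrite len_code.
        specialize (H (unpair1 n) l). lia.
      * intros H j l. specialize (H (pair j (code l))).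
        rewrite unpair1_pair, unpair2_pair, len_code in H. lia.
  - apply query_class_intro with
      (G := fun n v _ _ => (2 ^ hexp p q n - 2 ^ M * v)%nat)
      (a := fun n => pair 2 (pair n 0)) (b := fun n => n) (c := fun n => n);
      unfold recursive; auto with recdb.
    + apply rec_sub; [apply rec_pow, rec_hexp; auto with recdb|auto with recdb].
    + intros f; split; intros H n; specialize (H n); lia.
Qed.

Definition certified (f : nat -> nat) (x : nat -> bool) : Prop :=
  forall n, f (pair 1 (code (map b2n (pre x n)))) <> 0%nat.

Lemma map_b2n_pre x n : map b2n (pre x n) = rev (restrb x n).
Proof. unfold restrb. now rewrite <- rev_pre, rev_involutive, map_pre. Qed.

Lemma Pi01_certified f : Pi01_in f (certified f).
Proof.
  exists (fun c => 1 - f (pair 1 (rev_code c)))%nat. split.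
  - apply rec_sub; [apply rec_const|]. apply (r_comp _ f); [apply r_oracle|auto with recdb].
  - intros x; split; intros H n; specialize (H n).
    + rewrite rev_code_code, <- map_b2n_pre. lia.
    + rewrite rev_code_code, <- map_b2n_pre in H. lia.
Qed.

Lemma tree_check_0 R l d w i :
  tree_check R (S (code d)) w (code l) i = 0%nat ->
  R (pair (code (rev (skipn i l))) (code (rev (skipn i d)))) = 0%nat /\
  (skipn i l = [] -> skipn i d = []) /\
  (skipn i l <> [] -> exists b d', skipn i d = b :: d' /\ (b <= w)%nat).
Proof.
  unfold tree_check. cbn [ifz pred]. rewrite !iter_tl_code, !rev_code_code. intros H.
  destruct (skipn i l) as [|a l'], (skipn i d) as [|b d'];
    cbn [code ifz] in *; repeat split; try congruence; try lia.
  rewrite hd_code_cons in H || change (S (pair b (code d'))) with (code (b :: d')) in H.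
  rewrite ?hd_code_cons in H.
  intros _. exists b, d'. split; auto. lia.
Qed.

(** The witnesses attached to successive prefixes of [x] need not cohere. Since all truncations of
    each are checked against the same bounds, the admissible strings form a finitely branching tree
    with members on every level, and a path through it is a witness for [x]. *)
Lemma certified_sub R p q M f x : certificate R p q M f -> certified f x ->
  exists y : nat -> nat, forall n, R (pair (code (restrb x n)) (code (restr y n))) = 0%nat.
Proof.
  intros [Hf _] Hx.
  set (X := fun i => b2n (x i)).
  set (B := fun j => f (pair 0 (code (pre X (S j))))).
  destruct (koenig (fun d => (forall i, R (pair (code (rev (pre X (length d - i))))
        (code (rev (skipn i d)))) = 0%nat) /\
      forall i b d', skipn i d = b :: d' -> (b <= B (length d'))%nat)
      (fun j => seq 0 (S (B j)))) as [y Hy].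
  - intros a l [H1 H2]. split; [split|].
    + intros i. apply (H1 (S i)).
    + intros i. apply (H2 (S i)).
    + apply in_seq. specialize (H2 0%nat a l eq_refl). lia.
  - intros n. specialize (Hx n). rewrite map_pre in Hx. fold X in Hx.
    destruct (f (pair 1 (code (pre X n)))) as [|v] eqn:E; [congruence|].
    destruct (code_surj v) as [d <-]. exists d.
    assert (H : forall i, R (pair (code (rev (pre X (n - i)))) (code (rev (skipn i d)))) = 0%nat /\
        (pre X (n - i) = [] -> skipn i d = []) /\
        (pre X (n - i) <> [] -> exists b d', skipn i d = b :: d' /\
           (b <= f (pair 0%nat (code (pre X (n - i)))))%nat)).
    { intros i. rewrite <- !(skipn_pre X n i). apply tree_check_0. rewrite <- E. apply Hf. }
    (* Truncating by [n] leaves nothing of [d], while truncating by [n - 1] leaves something. *)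
    assert (Hlen : length d = n).
    { destruct (H n) as [_ [H1 _]]. rewrite Nat.sub_diag in H1. specialize (H1 eq_refl).
      apply (f_equal (@length nat)) in H1. rewrite length_skipn in H1. simpl in H1.
      destruct n as [|n]; [lia|].
      destruct (H n) as [_ [_ H2]]. replace (S n - n)%nat with 1%nat in H2 by lia.
      destruct H2 as [b [d' [H2 _]]]; [discriminate|].
      apply (f_equal (@length nat)) in H2. rewrite length_skipn in H2. simpl in H2. lia. }
    split; auto. split; [rewrite Hlen; apply H|].
    intros i b d' Hd.
    assert (Hl : (length d - i)%nat = S (length d')).
    { apply (f_equal (@length nat)) in Hd. now rewrite length_skipn in Hd. }
    destruct (H i) as [_ [_ H2]]. rewrite <- Hlen, Hl in H2.
    destruct H2 as [b' [d'' [H2 H3]]]; [discriminate|].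
    rewrite Hd in H2. injection H2 as <- <-. exact H3.
  - exists y. intros n. destruct (Hy n) as [H _]. specialize (H 0%nat).
    rewrite pre_length, Nat.sub_0_r in H. simpl skipn in H. rewrite !rev_pre in H. exact H.
Qed.

Lemma ext_cons_inv s b u : ext s (b :: u) -> s = b :: u \/ ext s u.
Proof.
  intros [[|a l] H]; [now left|]. injection H as _ ->. right; now exists l.
Qed.

Lemma rsum_filter_ge {X} (F : X -> R) b l a :
  (forall a, 0 <= F a) -> In a l -> b a = true -> F a <= rsum F (filter b l).
Proof.
  intros HF Hin Hb; induction l as [|c l IH]; [destruct Hin|]. simpl.
  pose proof (rsum_nonneg F (filter b l) HF).
  destruct Hin as [->|Hin].
  - rewrite Hb; simpl; lra.
  - specialize (IH Hin). destruct (b c); simpl; [specialize (HF c)|]; lra.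
Qed.

Lemma INR_pow2 n : INR (2 ^ n) = 2 ^ n.
Proof. rewrite pow_INR. reflexivity. Qed.

(** Koenig's lemma is applied to the tree in which strings of length [k] avoid only the first [k]
    cylinders, a finite condition. If level [k] were empty, the values of [f] would be a flow of at
    least [/ 2 ^ M] from the root ending inside these cylinders, each of which absorbs at most its
    weight. *)
Lemma certified_Hs_pos R p q M f : (0 < p)%nat -> (p < q)%nat ->
  certificate R p q M f -> Hs_pos (INR p / INR q) (certified f).
Proof.
  intros Hp Hpq [_ [Htl [Hadd [Hleaf [Hwt Hroot]]]]].
  apply content_Hs_pos with (/ 2 ^ M); auto; [apply inv_pow2_pos|].
  intros s Hs. assert (Hq : (0 < q)%nat) by lia. pose proof (weight_wt p q Hq) as Hw.
  set (T := fun u => f (pair 1 (code (map b2n u))) <> 0%nat).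
  set (v := fun j u => f (pair 2 (pair j (code (map b2n u))))).
  destruct (koenig (fun u => T u /\ forall i, (i < length u)%nat -> ~ ext (s i) u)
              (fun _ => [true; false])) as [x Hx].
  - intros a u [H1 H2]. split; [split|].
    + apply (Htl _ H1).
    + intros i Hi He. apply (H2 i); [simpl; lia|]. now apply ext_cons.
    + destruct a; simpl; auto.
  - intros k. apply NNPP; intros Hno.
    set (F := fun i => wt p q (length (s i))).
    assert (HF : forall i, 0 <= F i) by (intros i; left; apply Hw).
    assert (Hself : forall j u, (length u + j)%nat = k ->
      INR (v j u) / 2 ^ hexp p q k <= wt p q (length u)).
    { intros j u Hk. pose proof (Hwt j (map b2n u)) as H.
      rewrite length_map, Hk in H. apply le_INR in H. rewrite mult_INR, !INR_pow2 in H.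
      pose proof (pow_lt 2 (hexp p q k)). pose proof (pow_lt 2 (hexp p q (length u))).
      unfold wt. apply Rmult_le_reg_r with (2 ^ hexp p q k); [lra|].
      unfold Rdiv. rewrite Rmult_assoc, Rinv_l by lra.
      apply Rmult_le_reg_l with (2 ^ hexp p q (length u)); [lra|].
      rewrite <- (Rmult_assoc _ (/ _)), Rinv_r by lra. unfold v; lra. }
    (* Induction on the distance [j] to level [k], for [u] that has no [s i] as a proper prefix. If
       some [s i] is [u], its weight pays for [u]; otherwise the children are paid for by disjoint
       sets of indices. *)
    assert (Hclaim : forall j u, (length u + j)%nat = k ->
      (forall i, (i < k)%nat -> ext (s i) u -> s i = u) ->
      INR (v j u) / 2 ^ hexp p q k <=
        rsum F (filter (fun i => classicb (ext u (s i))) (seq 0 k))).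
    { induction j as [|j IH]; intros u Hk Hu;
        (destruct (classic (exists i, (i < k)%nat /\ s i = u)) as [[i [Hi Hiu]]|Hnu];
         [apply Rle_trans with (F i);
          [unfold F; rewrite Hiu; auto
          |apply rsum_filter_ge; [auto|apply in_seq; lia|apply classicb_intro; rewrite Hiu; apply ext_refl]]
         |]).
      (* A nonzero value would put [u] into the tree, and [u] avoids the first [k] cylinders,
         although level [k] is empty. *)
      - assert (v 0%nat u = 0%nat) as ->.
        { destruct (Nat.eq_dec (v 0%nat u) 0) as [|Hv]; auto. exfalso. apply Hno. exists u.
          rewrite Nat.add_0_r in Hk. repeat split; auto.
          - exact (Hleaf _ Hv).
          - rewrite Hk. intros i Hi He. apply Hnu; eauto. }
        simpl INR. unfold Rdiv; rewrite Rmult_0_l. apply rsum_nonneg; auto.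
      - assert (Hch : forall b i, (i < k)%nat -> ext (s i) (b :: u) -> s i = b :: u).
        { intros b i Hi He. destruct (ext_cons_inv _ _ _ He) as [|He']; auto.
          exfalso; apply Hnu; eauto. }
        pose proof (IH (false :: u) ltac:(simpl; lia) (Hch false)) as H0.
        pose proof (IH (true :: u) ltac:(simpl; lia) (Hch true)) as H1.
        assert (H2 : INR (v (S j) u) <= INR (v j (false :: u)) + INR (v j (true :: u))).
        { rewrite <- plus_INR. apply le_INR, (Hadd j (map b2n u)). }
        assert (H3 : 0 < / 2 ^ hexp p q k) by apply inv_pow2_pos.
        apply Rle_trans with (INR (v j (false :: u)) / 2 ^ hexp p q k +
          INR (v j (true :: u)) / 2 ^ hexp p q k).
        + unfold Rdiv; rewrite <- Rmult_plus_distr_r. apply Rmult_le_compat_r; lra.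
        + eapply Rle_trans; [apply Rplus_le_compat; [exact H0|exact H1]|].
          apply rsum_filter2_le; auto; intros i.
          * intros H; apply classicb_true in H. apply classicb_intro.
            apply ext_trans with (false :: u); auto. now exists [false].
          * intros H; apply classicb_true in H. apply classicb_intro.
            apply ext_trans with (true :: u); auto. now exists [true].
          * intros Ha Hb. apply classicb_true in Ha, Hb.
            apply (ext_comparable _ _ _ Ha) in Hb; [|simpl; lia].
            apply ext_eq in Hb; [discriminate|simpl; lia]. }
    specialize (Hclaim k [] eq_refl).
    assert (H : INR (v k []) / 2 ^ hexp p q k <= rsum F (seq 0 k)).
    { eapply Rle_trans; [apply Hclaim|apply rsum_filter_le; auto].
      intros i _ [l He]. symmetry in He. now apply app_eq_nil in He. }
    specialize (Hs k). fold F in Hs. specialize (Hroot k). apply le_INR in Hroot.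
    rewrite mult_INR, !INR_pow2 in Hroot.
    change (f (pair 2 (pair k 0))) with (v k []) in Hroot.
    pose proof (pow_lt 2 (hexp p q k)). pose proof (pow_lt 2 M).
    assert (/ 2 ^ M <= INR (v k []) / 2 ^ hexp p q k); [|lra].
    apply Rmult_le_reg_l with (2 ^ M); [lra|]. rewrite Rinv_r by lra.
    apply Rmult_le_reg_r with (2 ^ hexp p q k); [lra|].
    unfold Rdiv. rewrite Rmult_assoc, (Rmult_assoc (INR _)), Rinv_l; lra.
  - exists x; split.
    + intros n. apply Hx.
    (* A level beyond [i], where [s i] is already forbidden, and beyond [length (s i)], where the
       prefix of [x] would extend it. *)
    + intros i Hc. destruct (Hx (S (i + length (s i)))) as [_ H]. apply (H i).
      * rewrite pre_length; lia.
      * apply (cyl_comparable _ _ x); auto; [apply cyl_pre|rewrite pre_length; lia].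
Qed.

(** * Existence of certificates *)

Fixpoint bounded_by (l : list nat) (y : nat -> nat) : Prop :=
  match l with
  | [] => True
  | a :: l' => (y (length l') <= a)%nat /\ bounded_by l' y
  end.

(** Only the first [length l] values of the witness are bounded: [[]] gives the whole projection,
    and the sets for [a :: l] increase with [a] to the set for [l]. *)
Definition bounded_projection (R : nat -> nat) (l : list nat) (x : nat -> bool) : Prop :=
  exists y, bounded_by l y /\ forall n, R (pair (code (restrb x n)) (code (restr y n))) = 0%nat.

Lemma bounded_by_pre g y k : bounded_by (pre g k) y -> forall i, (i < k)%nat -> (y i <= g i)%nat.
Proof.
  induction k as [|k IH]; simpl; intros H i Hi; [lia|]. rewrite pre_length in H.
  destruct (Nat.eq_dec i k) as [->|]; [tauto|]. apply IH; [tauto|lia].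
Qed.

Lemma bounding_function R wt t :
  weight wt -> 0 < t -> ~ cov wt (bounded_projection R []) t ->
  exists g, forall k, ~ cov wt (bounded_projection R (pre g k)) (t / 2).
Proof.
  intros Hw Ht H.
  (* The invariant says that the content is strictly above [t / 2]. It passes to some [a :: l]
     without loss, for if all these sets had content at most [t / 2], continuity would give the same
     for their union. *)
  destruct (dependent_choice (fun l =>
    ~ forall e, 0 < e -> cov wt (bounded_projection R l) (t / 2 + e))) as [g Hg].
  - intros Hc. apply H. replace t with (t / 2 + t / 2) by lra. apply Hc; lra.
  - intros l Hl. apply NNPP; intros Hno. apply Hl. intros e He.
    apply cov_mono with (fun x => exists a, bounded_projection R (a :: l) x) (t / 2 + e / 2 + e / 2);
      [|lra|].
    + intros x [y [Hy Hn]]. exists (y (length l)), y. simpl; auto.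
    + apply cov_increasing; auto; [| |lra].
      * intros n m x Hnm [y [[Hy1 Hy2] Hy3]]. exists y; simpl; repeat split; auto; lia.
      * intros a. assert (Ha : ~ ~ forall e, 0 < e -> cov wt (bounded_projection R (a :: l)) (t / 2 + e))
          by eauto.
        apply NNPP in Ha. apply Ha; lra.
  - exists g. intros k Hc. apply (Hg k). intros e He.
    apply cov_mono with (bounded_projection R (pre g k)) (t / 2); auto; lra.
Qed.

(** The minimum cut: the least cost of covering the strings of [T] that lie [j] levels above [l],
    using [l] itself or covers of both halves. The unit is the weight at level [length l + j], and
    costs are integers because [hexp] is nondecreasing. *)
Fixpoint tree_content (p q : nat) (T : list nat -> Prop) (j : nat) (l : list nat) : nat :=
  match j with
  | O => if classicb (T l) then 1 else 0
  | S i => Nat.min (2 ^ (hexp p q (length l + j) - hexp p q (length l)))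
             (tree_content p q T i (0%nat :: l) + tree_content p q T i (1%nat :: l))
  end.

Lemma hexp_le p q n m : (0 < q)%nat -> (n <= m)%nat -> (hexp p q n <= hexp p q m)%nat.
Proof.
  intros Hq H; induction H; auto. eapply Nat.le_trans; [eassumption|now apply hexp_mono].
Qed.

Lemma tree_content_wt p q T j l : (0 < q)%nat ->
  (tree_content p q T j l * 2 ^ hexp p q (length l) <= 2 ^ hexp p q (length l + j))%nat.
Proof.
  intros Hq. destruct j as [|j]; cbn [tree_content].
  - rewrite Nat.add_0_r. destruct classicb; lia.
  - pose proof (hexp_le p q (length l) (length l + S j) Hq) as H.
    rewrite <- (Nat.sub_add (hexp p q (length l)) (hexp p q (length l + S j))) at 2 by lia.
    rewrite Nat.pow_add_r. apply Nat.mul_le_mono_r, Nat.le_min_l.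
Qed.

(** The recursion, read as the construction of a cover, so that large content forces large values of
    [tree_content]. *)
Lemma tree_content_cov p q T j s : (0 < q)%nat ->
  cov (wt p q) (fun x => cyl s x /\ T (map b2n (pre x (length s + j))))
    (INR (tree_content p q T j (map b2n s)) / 2 ^ hexp p q (length s + j)).
Proof.
  intros Hq. pose proof (weight_wt p q Hq) as Hw.
  revert s; induction j as [|j IH]; intros s; cbn [tree_content].
  - unfold classicb. rewrite Nat.add_0_r. destruct excluded_middle_informative as [HT|HT].
    + apply cov_mono with (cyl s) (wt p q (length s)); [tauto| |now apply cov_cyl].
      simpl INR. unfold wt; lra.
    + apply cov_mono with (fun _ : nat -> bool => False) 0.
      * intros x [Hx HTx]. apply HT. unfold cyl in Hx. now rewrite Hx in HTx.
      * simpl INR; lra.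
      * apply cov_empty; auto.
  - rewrite length_map. apply Nat.min_case.
    + apply cov_mono with (cyl s) (wt p q (length s)); [tauto| |now apply cov_cyl].
      pose proof (hexp_le p q (length s) (length s + S j) Hq) as H.
      rewrite INR_pow2. unfold wt.
      pattern (hexp p q (length s + S j)) at 2.
      rewrite <- (Nat.sub_add (hexp p q (length s)) (hexp p q (length s + S j))) by lia.
      rewrite pow_add.
      pose proof (pow_lt 2 (hexp p q (length s))).
      pose proof (pow_lt 2 (hexp p q (length s + S j) - hexp p q (length s))).
      right. field. lra.
    + rewrite plus_INR. unfold Rdiv. rewrite Rmult_plus_distr_r.
      replace (length s + S j)%nat with (S (length s) + j)%nat by lia.
      apply cov_union2 with
        (fun x => cyl (false :: s) x /\ T (map b2n (pre x (length (false :: s) + j))))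
        (fun x => cyl (true :: s) x /\ T (map b2n (pre x (length (true :: s) + j))));
        [|apply (IH (false :: s))|apply (IH (true :: s))].
      intros x [Hx HT]. apply cyl_child in Hx. destruct (x (length s)); auto.
Qed.

Definition bounded_tree (R : nat -> nat) (g : nat -> nat) (l d : list nat) : Prop :=
  length d = length l /\
  (forall i, R (pair (code (rev (skipn i l))) (code (rev (skipn i d)))) = 0%nat) /\
  (forall i b d', skipn i d = b :: d' -> (b <= g (length d'))%nat).

Lemma tree_check_intro R l d i g :
  bounded_tree R g l d ->
  tree_check R (S (code d)) (g (pred (length (skipn i l)))) (code l) i = 0%nat.
Proof.
  intros [Hlen [HR Hb]]. unfold tree_check. cbn [ifz pred].
  rewrite !iter_tl_code, !rev_code_code, HR.
  assert (Hl : length (skipn i d) = length (skipn i l)) by (rewrite !length_skipn; lia).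
  destruct (skipn i l) as [|a l'], (skipn i d) as [|b d'] eqn:E; try discriminate; auto.
  rewrite hd_code_cons. cbn [code ifz length pred] in *. injection Hl as Hl.
  specialize (Hb i b d' E). rewrite Hl in Hb. lia.
Qed.

Lemma certificate_exists R p q t : (0 < q)%nat -> 0 < t ->
  ~ cov (wt p q) (bounded_projection R []) t -> exists M f, certificate R p q M f.
Proof.
  intros Hq Ht Hcov. pose proof (weight_wt p q Hq) as Hw.
  destruct (bounding_function R _ t Hw Ht Hcov) as [g Hg].
  destruct (inv_pow2_small (t / 2)) as [M HM]; [lra|].
  set (T := fun l => exists d, bounded_tree R g l d).
  assert (Hwit : forall l, exists v, (T l -> exists d, v = S (code d) /\ bounded_tree R g l d) /\
      (~ T l -> v = 0%nat)).
  { intros l. destruct (classic (T l)) as [[d Hd]|Hn].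
    - exists (S (code d)). split; eauto. intros H; exfalso; apply H; now exists d.
    - exists 0%nat; tauto. }
  set (wit := fun l => proj1_sig (constructive_indefinite_description _ (Hwit l))).
  assert (Hw1 : forall l, (T l -> exists d, wit l = S (code d) /\ bounded_tree R g l d) /\
      (~ T l -> wit l = 0%nat)).
  { intros l; exact (proj2_sig (constructive_indefinite_description _ (Hwit l))). }
  (* The certificate holds the bounds [g], actual witnesses and exact minimum cuts. The last entry
     of a string of length [n + 1] has position [n], whence [pred]. *)
  set (f := fun n => match unpair1 n with
    | 0%nat => g (pred (length (decode (unpair2 n))))
    | 1%nat => wit (decode (unpair2 n))
    | _ => tree_content p q T (unpair1 (unpair2 n)) (decode (unpair2 (unpair2 n)))
    end).
  assert (Hf0 : forall l, f (pair 0 (code l)) = g (pred (length l))).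
  { intros l; unfold f. now rewrite unpair1_pair, unpair2_pair, decode_code. }
  assert (Hf1 : forall l, f (pair 1 (code l)) = wit l).
  { intros l; unfold f. now rewrite unpair1_pair, unpair2_pair, decode_code. }
  assert (Hf2 : forall j l, f (pair 2 (pair j (code l))) = tree_content p q T j l).
  { intros j l; unfold f. now rewrite unpair1_pair, !unpair2_pair, unpair1_pair, decode_code. }
  assert (HT : forall l, wit l <> 0%nat <-> T l).
  { intros l. destruct (Hw1 l) as [H1 H2]. split.
    - intros H. apply NNPP; auto.
    - intros H. destruct (H1 H) as [d [-> _]]. discriminate. }
  exists M, f. split; [|split; [|split; [|split; [|split]]]].
  - intros l i. rewrite Hf0, Hf1. destruct (Hw1 l) as [H1 H2].
    destruct (classic (T l)) as [H|H].
    + destruct (H1 H) as [d [-> Hd]]. now apply tree_check_intro.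
    + rewrite (H2 H). reflexivity.
  - intros l. rewrite !Hf1, !HT. intros [d [H1 [H2 H3]]].
    exists (tl d). destruct l as [|a l], d as [|b d]; try discriminate.
    + repeat split; auto.
    + injection H1 as H1. repeat split; auto.
      * intros i; apply (H2 (S i)).
      * intros i; apply (H3 (S i)).
  - intros j l. rewrite !Hf2. apply Nat.le_min_r.
  - intros l. rewrite Hf2, Hf1, HT. cbn [tree_content].
    destruct (classicb (T l)) eqn:E; [|congruence]. now apply classicb_true in E.
  - intros j l. rewrite Hf2. now apply tree_content_wt.
  - intros j. change 0%nat with (code []). rewrite Hf2.
    (* A smaller value at the root would give a cover of the set bounded by [pre g j] of cost below
       [/ 2 ^ M], hence below [t / 2], against the choice of [g]. *)
    apply Nat.nlt_ge. intros Hlt. apply (Hg j).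
    pose proof (tree_content_cov p q T j [] Hq) as Hc. simpl in Hc.
    eapply cov_mono; [| |exact Hc].
    + intros x [y [Hy Hn]]. split; [reflexivity|]. exists (pre y j). repeat split.
      * now rewrite length_map, !pre_length.
      * intros i. rewrite map_pre, !skipn_pre, !rev_pre. apply Hn.
      * intros i b d' Hd. rewrite skipn_pre in Hd.
        destruct (j - i)%nat as [|k] eqn:Ek; [discriminate|]. injection Hd as <- <-.
        rewrite pre_length. apply (bounded_by_pre g y j Hy). lia.
    + apply lt_INR in Hlt. rewrite mult_INR, !INR_pow2 in Hlt.
      pose proof (pow_lt 2 (hexp p q j)). pose proof (pow_lt 2 M).
      apply Rle_trans with (/ 2 ^ M); [|lra].
      apply Rmult_le_reg_r with (2 ^ hexp p q j); [lra|].
      unfold Rdiv. rewrite Rmult_assoc, Rinv_l by lra.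
      apply Rmult_le_reg_l with (2 ^ M); [lra|].
      rewrite <- (Rmult_assoc _ (/ _)), Rinv_r; lra.
Qed.

Lemma basis_Pi01_subclass p q B E : (0 < p)%nat -> (p < q)%nat ->
  Sigma11_basis B -> Sigma11_cantor E -> Hs_pos (INR p / INR q) E ->
  exists f, B f /\
    exists C, Pi01_in f C /\ (forall x, C x -> E x) /\ Hs_pos (INR p / INR q) C.
Proof.
  intros Hp Hpq HB [R [HR HE]] Hpos. assert (Hq : (0 < q)%nat) by lia.
  destruct (Hs_pos_content p q E Hp Hq Hpos) as [t [Ht Hcov]].
  destruct (certificate_exists R p q t Hq Ht) as [M Hcert].
  { intros Hc. apply Hcov. apply cov_mono with (bounded_projection R []) t; auto; [|lra].
    intros x Hx. apply HE in Hx as [y Hy]. exists y; simpl; auto. }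
  (* Of all that was chosen for [E], only the number [M] enters the class of certificates, which is
     therefore lightface although [g] need not be recursive. *)
  destruct (HB _ (query_class_Sigma11 _ (query_class_certificate R p q M HR Hq)) Hcert)
    as [f [Hf HBf]].
  exists f; split; auto. exists (certified f). split; [apply Pi01_certified|split].
  - intros x Hx. apply HE. eapply certified_sub; eauto.
  - eapply certified_Hs_pos; eauto.
Qed.

Theorem mainTheorem13 :
  forall (p q : nat), (0 < p)%nat -> (p < q)%nat ->
  let s := INR p / INR q in
  (forall (B : (nat -> nat) -> Prop) (E : (nat -> bool) -> Prop),
      Sigma11_basis B -> Sigma11_cantor E -> Hs_pos s E ->
      exists f, B f /\
        exists C : (nat -> bool) -> Prop,
          Pi01_in f C /\ (forall x, C x -> E x) /\ Hs_pos s C)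
  /\
  (forall (O : nat -> Prop) (o : nat -> nat) (E : (nat -> bool) -> Prop),
      Pi11_complete O -> char_fun O o ->
      Sigma11_cantor E -> Hs_pos s E ->
      exists C : (nat -> bool) -> Prop,
        Pi01_in o C /\ (forall x, C x -> E x) /\ Hs_pos s C).
Proof.
  intros p q Hp Hpq s. split.
  - intros B E. now apply basis_Pi01_subclass.
  - intros O o E HO Ho HE Hpos.
    destruct (basis_Pi01_subclass p q _ E Hp Hpq (Kleene_basis O o HO Ho) HE Hpos)
      as [f [Hf [C [[R [HR HC]] HC']]]].
    exists C; split; auto. exists R; split; auto. now apply rec_in_trans with f.
Qed.
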